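(* Let $\mathfrak{A}\subseteq\mathcal{B}(\mathcal{H})$ be a transitive algebra. Then the following conditions are equivalent: (1) $\mathfrak{A}$ is $2$-fold transitive; (2) if $S$ is a closed, densely defined operator on $\mathcal{H}$, with domain $\mathcal{D}(S)$, such that $TS=ST$ for every $T\in\mathfrak{A}$, i.e., for any $\xi\in\mathcal{D}(S)$, $TS\xi=ST\xi$ (in particular $T\xi\in\mathcal{D}(S)$), then $S=\lambda I$ for some scalar $\lambda$; (3) for any $\xi,\eta,\zeta\in\mathcal{H}$ with $\xi\neq0$, there exists a sequence $T_n$ in $\mathfrak{A}$ such that $T_n\xi$ converges to $\zeta$ and $\sup_n\|T_n\eta\|<\infty$; (4) $\mathrm{Lat}\,\mathfrak{A}^{(2)}=\mathrm{Lat}\,\mathcal{B}(\mathcal{H})^{(2)}$, i.e., for any projection $P\in M_2(\mathbb{C})\bar\otimes\mathcal{B}(\mathcal{H})$, if $P\in\mathrm{Lat}(\mathbb{C}I_2\bar\otimes\mathfrak{A})$, then $P\in M_2(\mathbb{C})\bar\otimes\mathbb{C}I$.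
   Context: $\mathcal{H}$ is a complex Hilbert space. A subalgebra $\mathfrak{A}\subseteq\mathcal{B}(\mathcal{H})$ (not assumed self-adjoint or closed) is transitive if it contains the identity operator and has no invariant closed subspaces other than $\{0\}$ and $\mathcal{H}$. It is $2$-fold transitive if for any linearly independent $\xi,\eta\in\mathcal{H}$ the norm closure of $\{(T\xi,T\eta):T\in\mathfrak{A}\}$ is $\mathcal{H}^{(2)}=\mathcal{H}\oplus\mathcal{H}$. $T^{(2)}=T\oplus T$ on $\mathcal{H}^{(2)}$ and $\mathfrak{A}^{(2)}=\{T^{(2)}:T\in\mathfrak{A}\}=\mathbb{C}I_2\bar\otimes\mathfrak{A}$. $\mathcal{B}(\mathcal{H}^{(2)})$ is identified with $M_2(\mathbb{C})\bar\otimes\mathcal{B}(\mathcal{H})$ ($2\times2$ matrices over $\mathcal{B}(\mathcal{H})$); $M_2(\mathbb{C})\bar\otimes\mathbb{C}I$ are the matrices with scalar-operator entries. $\mathrm{Lat}$ of a set of operators is the collection of closed subspaces invariant under all of them; subspaces are identified with the orthogonal projections onto them, so $P\in\mathrm{Lat}\,T$ iff $PTP=TP$. *)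

(* Defs.v *)
From HB Require Import structures.
From mathcomp Require Import all_boot all_order all_algebra.
From mathcomp Require Import sesquilinear complex.
From mathcomp Require Import all_classical all_reals topology normedtype.

Set Implicit Arguments.
Unset Strict Implicit.
Unset Printing Implicit Defensive.

Import Order.TTheory GRing.Theory Num.Theory.
Import numFieldNormedType.Exports.

Local Open Scope classical_set_scope.
Local Open Scope complex_scope.
Local Open Scope ring_scope.

(* The inner product is linear in its first argument. *)
HB.mixin Record CompleteNormedModule_isHilbert (R : realType) H
    of CompleteNormedModule R[i] H := {
  inner : {dot H for (@Num.conj R[i])};
  sqr_norm_inner : forall x : H, `|x| ^+ 2 = inner x x }.

#[short(type="hilbertType")]
HB.structure Definition Hilbert (R : realType) :=
  {H of CompleteNormedModule_isHilbert R H & CompleteNormedModule R[i] H}.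

Section Operators.
Context {K : numFieldType} {E : normedModType K}.
Implicit Types (M : set E) (F : set (E -> E)).

Definition bounded_operators : set (E -> E) :=
  [set T | linear T /\ continuous T].

Definition linear_subspace M : Prop :=
  M 0 /\ forall (a : K) x y, M x -> M y -> M (a *: x + y).

Definition Lat F : set (set E) :=
  [set M | [/\ linear_subspace M, closed M &
    forall T, F T -> forall x, M x -> M (T x)]].

Definition subalgebra F : Prop :=
  [/\ F `<=` bounded_operators, F (cst 0),
    forall (a : K) T S, F T -> F S -> F (fun x => a *: T x + S x) &
    forall T S, F T -> F S -> F (T \o S)].

Definition transitive_algebra F : Prop :=
  [/\ subalgebra F, F id & Lat F `<=` [set [set 0]; setT]].

Definition lin_indep2 (x y : E) : Prop :=
  forall a b : K, a *: x + b *: y = 0 -> a = 0 /\ b = 0.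

Definition two_fold_transitive F : Prop :=
  forall x y, lin_indep2 x y -> closure [set (T x, T y) | T in F] = setT.

(* The values of [fn] outside [dom] are irrelevant. *)
Record unbounded_operator := UnboundedOperator {
  dom : set E;
  fn : E -> E;
  dom_subspace : linear_subspace dom;
  fn_linear : forall (a : K) x y, dom x -> dom y ->
    fn (a *: x + y) = a *: fn x + fn y }.

Definition closed_operator (S : unbounded_operator) : Prop :=
  closed [set (x, fn S x) | x in dom S].

Definition commutes_with (T : E -> E) (S : unbounded_operator) : Prop :=
  forall x, dom S x -> dom S (T x) /\ T (fn S x) = fn S (T x).

Definition is_scalar (S : unbounded_operator) : Prop :=
  exists l : K, dom S = setT /\ forall x, fn S x = l *: x.

Definition ampliation2 (T : E -> E) : (E * E -> E * E) :=
  fun u => (T u.1, T u.2).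

(* [a : 'M_2] seen in M_2(B(E)) = B(E + E), with entries the scalar operators
   [a i j *: id]. *)
Definition scalar_operator2 (a : 'M[K]_2) : (E * E -> E * E) :=
  fun u => (a 0 0 *: u.1 + a 0 1 *: u.2, a 1 0 *: u.1 + a 1 1 *: u.2).

End Operators.
Arguments bounded_operators {K} E.
Arguments unbounded_operator {K} E.

Section HilbertSum.
Context {R : realType} {H : hilbertType R}.

(* The library norm on [H * H] is the max norm. It is equivalent to the norm of
   [inner2] (see [norm_inner2]), so it has the same closed sets and the same
   bounded operators as the Hilbert sum. *)
Definition inner2 (u v : H * H) : R[i] := inner u.1 v.1 + inner u.2 v.2.

Lemma norm_inner2 (u : H * H) : `|u| ^+ 2 <= inner2 u u <= 2 * `|u| ^+ 2.
Proof.
have uE : inner2 u u = `|u.1| ^+ 2 + `|u.2| ^+ 2.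
  by rewrite /inner2 !sqr_norm_inner.
have {uE} -> := uE; have -> : `|u| = Num.max `|u.1| `|u.2| by [].
have le2 (a b : R[i]) : 0 <= a -> a <= b ->
    b ^+ 2 <= a ^+ 2 + b ^+ 2 <= 2 * b ^+ 2.
  move=> a0 ab; rewrite lerDr exprn_ge0//= mulr_natl mulr2n lerD2r.
  by rewrite lerXn2r// nnegrE// (le_trans a0).
have /orP[h|h] :=
  real_leVge (normr_real u.1) (normr_real u.2).
- by rewrite max_r//; exact: le2.
- by rewrite max_l// addrC le2.
Qed.

Definition projection2 (P : H * H -> H * H) : Prop :=
  [/\ bounded_operators (H * H)%type P, P \o P = P &
    forall u v, inner2 (P u) v = inner2 u (P v)].

Lemma Lat_projection2 (F : set (H * H -> H * H)) (P : H * H -> H * H) :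
  projection2 P ->
  Lat F (range P) <-> forall T, F T -> P \o T \o P = T \o P.
Proof.
move=> [[Plin Pcont] PP _].
have PE u : P (P u) = P u by exact: (congr1 (@^~ u) PP).
have P0 : P 0 = 0.
  have := Plin (-1) 0 0; rewrite scaler0 addr0 scaleN1r => ->.
  by rewrite addNr.
have rangeE : range P = [set u | P u - u = 0].
  apply/seteqP; split=> [_ [u _ <-]|u /subr0_eq <-]; last by exists u.
  by rewrite /= PE subrr.
split=> [[_ _ FP] T FT|FP].
- apply/funext => u /=; have [|v _ <-] := FP T FT (P u); last exact: PE.
  by exists u.
- split.
  + split=> [|a _ _ [u _ <-] [v _ <-]]; first by exists 0 => //; exact: P0.
    by exists (a *: u + v) => //; exact: Plin.
  + rewrite rangeE; apply: (@closed_comp _ _ (fun u => P u - u) [set 0]).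
    * by move=> u _; apply: cvgB; [exact: Pcont|exact: cvg_id].
    * exact/accessible_closed_set1/hausdorff_accessible/norm_hausdorff.
  + move=> T FT _ [u _ <-].
    by exists (T (P u)) => //; exact: (congr1 (@^~ u) (FP T FT)).
Qed.

End HilbertSum.

(* Main.v *)
(* An invariant subspace M of the ampliation with no nonzero (0, z) is the graph
   of a closed operator commuting with A; otherwise transitivity makes M
   equal to {0} + H or H + H. This relates (1), (2) and (4), using rank-one
   operators and orthogonal projections for the converse directions.

   For (3) => (2), the sequences of (3) and a parallelogram-law substitute for
   weak compactness show that an invariant closed G in H + H containing some
   (x, y) with x != 0 meets every fiber {z} + H; by a Baire argument it does so
   in some (z, w) with |w| <= C |z|. Applied to the graph of S and to the graphs
   of the (S - l)^-1, this makes S bounded, and all S - l boundedly invertible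
   if S is not scalar. Then |(S - l)^-1 x| attains its maximum over l in the
   complex plane, contradicting the strict subharmonicity of its square. *)

Require Import Defs.
From HB Require Import structures.
From mathcomp Require Import all_boot all_order all_algebra.
From mathcomp Require Import sesquilinear complex.
From mathcomp Require Import all_classical all_reals topology normedtype.
From mathcomp Require Import derive ring lra.

Import Order.TTheory GRing.Theory Num.Theory.
Import numFieldNormedType.Exports.

Local Open Scope classical_set_scope.
Local Open Scope complex_scope.
Local Open Scope ring_scope.

(** * Real-valued norms *)

(* The norm takes its values in [R[i]], where the order is only partial. *)
Definition nm {R : realType} {V : normedZmodType R[i]} (x : V) : R :=
  complex.Re `|x|.

Section RealNorm.
Context {R : realType} {V : normedZmodType R[i]}.
Implicit Types (x y : V).

Lemma nmE x : `|x| = (nm x)%:C.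
Proof. by rewrite /nm RRe_real// normr_real. Qed.

Lemma nm_ge0 x : 0 <= nm x.
Proof. by rewrite -lecR -nmE normr_ge0. Qed.

Lemma nm_eq0 x : nm x = 0 -> x = 0.
Proof. by move=> x0; apply/eqP; rewrite -normr_eq0 nmE x0. Qed.

Lemma nm0 : nm (0 : V) = 0.
Proof. by rewrite /nm normr0. Qed.

Lemma nm_gt0 x : x != 0 -> 0 < nm x.
Proof.
move=> x0; rewrite lt_neqAle nm_ge0 andbT eq_sym.
by apply: contra_neq x0; exact: nm_eq0.
Qed.

Lemma nmD x y : nm (x + y) <= nm x + nm y.
Proof. by rewrite -lecR rmorphD/= -!nmE ler_normD. Qed.

Lemma nmN x : nm (- x) = nm x.
Proof. by rewrite /nm normrN. Qed.

Lemma nmB x y : nm (x - y) <= nm x + nm y.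
Proof. by rewrite (le_trans (nmD _ _))// nmN. Qed.

Lemma nm_distC x y : nm (x - y) = nm (y - x).
Proof. by rewrite -nmN opprB. Qed.

Lemma nm_distD x y z : nm (x - z) <= nm (x - y) + nm (y - z).
Proof. by rewrite (le_trans _ (nmD _ _))// addrA subrK. Qed.

End RealNorm.

Section RealNormModule.
Context {R : realType} {V : normedModType R[i]}.
Implicit Types (x y : V) (c : R[i]).

Lemma nm_real (r : R) : nm (r%:C) = `|r|.
Proof. by rewrite /nm normc_def/= expr0n addr0 sqrtr_sqr. Qed.

Lemma nmM (c d : R[i]) : nm (c * d) = nm c * nm d.
Proof. by apply: complexI; rewrite rmorphM/= -!nmE normrM. Qed.

Lemma nmZ c x : nm (c *: x) = nm c * nm x.
Proof. by apply: complexI; rewrite rmorphM/= -!nmE normrZ. Qed.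

Lemma nmZr (r : R) x : 0 <= r -> nm (r%:C *: x) = r * nm x.
Proof. by move=> r0; rewrite nmZ nm_real ger0_norm. Qed.

Lemma nm_ball (e : R) x y : ball x e%:C y <-> nm (x - y) < e.
Proof. by rewrite -ball_normE/= nmE ltcR. Qed.

Lemma nbhs_nm x (B : set V) :
  nbhs x B <-> exists2 e : R, 0 < e & forall y, nm (x - y) < e -> B y.
Proof.
split=> [/nbhs_ballP[e /= e0 B_]|[e e0 B_]].
  (* A positive element of [R[i]] is real, so ball radii may be taken in [R]. *)
  have eE : e = (complex.Re e)%:C by rewrite RRe_real// gtr0_real.
  exists (complex.Re e); first by rewrite -ltcR -eE.
  by move=> y xy; apply: B_; rewrite eE nm_ball.
apply/nbhs_ballP; exists e%:C; first by rewrite /= ltcR.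
by move=> y /nm_ball/B_.
Qed.

Lemma closure_nm (B : set V) x :
  closure B x <-> forall e : R, 0 < e -> exists2 y, B y & nm (x - y) < e.
Proof.
split=> [Bx e e0|Bx C /nbhs_nm[e e0 C_]].
  have /Bx[y [By xy]] : nbhs x [set y | nm (x - y) < e].
    by apply/nbhs_nm; exists e.
  by exists y.
by have [y By xy] := Bx e e0; exists y; split => //; exact: C_.
Qed.

Lemma closed_nm (B : set V) x : closed B ->
  (forall e : R, 0 < e -> exists2 y, B y & nm (x - y) < e) -> B x.
Proof. by move=> cB /closure_nm; exact: cB. Qed.

Lemma cvg_nm (u : nat -> V) x :
  u @ \oo --> x <->
  forall e : R, 0 < e -> exists N, forall n, (N <= n)%N -> nm (x - u n) < e.
Proof.
split=> [ux e e0|ux].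
  have /ux[N _ N_] : nbhs x [set y | nm (x - y) < e].
    by apply/nbhs_nm; exists e.
  by exists N => n /N_.
move=> C /nbhs_nm[e e0 C_]; have [N N_] := ux e e0.
by exists N => // n /= /N_; exact: C_.
Qed.

End RealNormModule.

Lemma cauchy_nm_cvg {R : realType} {V : completeNormedModType R[i]}
    (u : nat -> V) :
  (forall e : R, 0 < e -> exists N, forall n, (N <= n)%N ->
     nm (u N - u n) < e) ->
  exists x : V, u @ \oo --> x.
Proof.
move=> cu; suff /cvg_ex[x ux] : cvg (u @ \oo) by exists x.
apply: cauchy_cvg; suff : cauchy_ex (u @ \oo) by exact: cauchy_exP.
move=> e e0.
have eE : e = (complex.Re e)%:C by rewrite RRe_real// gtr0_real.
have [|N N_] := cu (complex.Re e); first by rewrite -ltcR -eE.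
by exists (u N), N => // n /= Nn; rewrite eE; apply/nm_ball; exact: N_.
Qed.

Section RealNormProduct.
Context {R : realType} {V W : normedModType R[i]}.
Implicit Types (u v : V * W).

Lemma nbhs_nm2 u (B : set (V * W)) :
  nbhs u B <-> exists2 e : R, 0 < e &
    forall v, nm (u.1 - v.1) < e -> nm (u.2 - v.2) < e -> B v.
Proof.
split=> [/nbhs_ballP[e /= e0 B_]|[e e0 B_]].
  have eE : e = (complex.Re e)%:C by rewrite RRe_real// gtr0_real.
  exists (complex.Re e); first by rewrite -ltcR -eE.
  by move=> v uv1 uv2; apply: B_; rewrite eE; split; exact/nm_ball.
apply/nbhs_ballP; exists e%:C; first by rewrite /= ltcR.
by move=> v [/nm_ball uv1 /nm_ball uv2]; exact: B_.
Qed.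

Lemma closure_nm2 (B : set (V * W)) u :
  closure B u <-> forall e : R, 0 < e ->
    exists2 v, B v & nm (u.1 - v.1) < e /\ nm (u.2 - v.2) < e.
Proof.
split=> [Bx e e0|Bx C /nbhs_nm2[e e0 C_]].
  have /Bx[y [By xy]] :
      nbhs u [set v | nm (u.1 - v.1) < e /\ nm (u.2 - v.2) < e].
    by apply/nbhs_nm2; exists e.
  by exists y.
by have [y By [xy xy']] := Bx e e0; exists y; split => //; exact: C_.
Qed.

Lemma closed_nm2 (B : set (V * W)) u : closed B ->
  (forall e : R, 0 < e ->
    exists2 v, B v & nm (u.1 - v.1) < e /\ nm (u.2 - v.2) < e) ->
  B u.
Proof. by move=> cB /closure_nm2; exact: cB. Qed.

End RealNormProduct.

(** * Parallelogram law, Pythagoras and Cauchy-Schwarz *)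

Section Inner.
Context {R : realType} {H : hilbertType R}.
Implicit Types (x y z w : H) (c : R[i]).

Lemma inner_nm x : inner x x = (nm x ^+ 2)%:C.
Proof. by rewrite -sqr_norm_inner nmE rmorphXn. Qed.

Lemma parallelogram x y :
  nm (x + y) ^+ 2 + nm (x - y) ^+ 2 = 2 * nm x ^+ 2 + 2 * nm y ^+ 2.
Proof.
apply: complexI; rewrite !mulr_natl !rmorphD !rmorphXn/= -!nmE.
rewrite !sqr_norm_inner dnormD dnormB.
by ring.
Qed.

Lemma innerC x y : inner x y = (inner y x)^*.
Proof. by rewrite hermC expr0 mul1r. Qed.

Lemma pythagoras x y :
  inner x y = 0 -> nm (x + y) ^+ 2 = nm x ^+ 2 + nm y ^+ 2.
Proof.
move=> xy; apply: complexI; rewrite !rmorphD !rmorphXn/= -!nmE.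
by rewrite !sqr_norm_inner hnormDd.
Qed.

(** With [c *: y] the orthogonal projection of [x] on the line of [y], Pythagoras gives
    [nm (c *: y) <= nm x]. *)
Lemma nm_inner_le x y : nm (inner x y) <= nm x * nm y.
Proof.
have [->|y0] := eqVneq y 0; first by rewrite linear0r !nm0 mulr0.
pose c := inner x y / inner y y.
have yy0 : inner y y != 0 by rewrite dnorm_eq0.
have cE : inner x y = c * inner y y by rewrite divfK.
have /pythagoras : inner (x - c *: y) (c *: y) = 0.
  by rewrite linearZr_LR/= linearBl linearZl_LR/= cE subrr mulr0.
rewrite subrK => xE.
have cx : nm (c *: y) <= nm x.
  by rewrite -ler_sqr ?nnegrE ?nm_ge0// xE lerDr sqr_ge0.
rewrite cE inner_nm nmM nm_real.
by rewrite ger0_norm ?sqr_ge0// expr2 mulrA -nmZ ler_wpM2r// nm_ge0.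
Qed.

End Inner.

(** * Near-minimizers and Baire's theorem *)

Lemma small_inv_nat {R : realType} {e : R} : 0 < e ->
  exists N : nat, forall n, (N <= n)%N -> n.+1%:R^-1 < e.
Proof.
move=> e0; exists (Num.trunc e^-1) => n Nn.
rewrite invf_plt ?posrE ?ltr0Sn//.
by rewrite (lt_le_trans (truncnS_gt _))// ler_nat ltnS.
Qed.

(** The restriction [e <= 1] lets quadratic errors be absorbed into linear ones. *)
Lemma ler_add_small_multiple {R : realType} (a b C : R) :
  (forall e : R, 0 < e -> e <= 1 -> a <= b + C * e) -> a <= b.
Proof.
move=> ab; apply/ler_addgt0Pl => e e0.
have C0 : 0 < `|C| + 1 + e by rewrite ltr_wpDl// addr_ge0.
have d0 : 0 < e / (`|C| + 1 + e) by rewrite divr_gt0.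
have d1 : e / (`|C| + 1 + e) <= 1 by rewrite ler_pdivrMr// mul1r lerDr addr_ge0.
rewrite (le_trans (ab _ d0 d1))// addrC lerD2r.
rewrite mulrCA ger_pMr//.
rewrite ler_pdivrMr// mul1r (le_trans (ler_norm _))// -addrA lerDl.
by rewrite addr_ge0// ltW.
Qed.

Lemma half_complex {R : realType} : 2^-1%:C + 2^-1%:C = 1 :> R[i].
Proof. by rewrite -rmorphD/= [X in X%:C](_ : _ = 1)//; lra. Qed.

Section ProductNorm.
Context {R : realType} {H : hilbertType R}.
Implicit Types (u v w : H * H) (x y z : H).

Definition sqnm u : R := nm u.1 ^+ 2 + nm u.2 ^+ 2.

Lemma inner2_sqnm u : inner2 u u = (sqnm u)%:C.
Proof. by rewrite rmorphD/= -!inner_nm. Qed.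

Lemma sqnm_ge0 u : 0 <= sqnm u.
Proof. by rewrite addr_ge0// sqr_ge0. Qed.

Lemma parallelogram2 u v :
  sqnm (u + v) + sqnm (u - v) = 2 * sqnm u + 2 * sqnm v.
Proof.
have := parallelogram u.1 v.1; have := parallelogram u.2 v.2.
by rewrite /sqnm /=; lra.
Qed.

Lemma sqnmZr (r : R) u : 0 <= r -> sqnm (r%:C *: u) = r ^+ 2 * sqnm u.
Proof. by move=> r0; rewrite /sqnm/= !nmZr// !exprMn mulrDr. Qed.

Lemma sqnm_lt u (e : R) : 0 < e -> sqnm u < e ^+ 2 -> nm u.1 < e /\ nm u.2 < e.
Proof.
move=> e0 ue; have := nm_ge0 u.1; have := nm_ge0 u.2.
by move: ue; rewrite /sqnm => *; split; nra.
Qed.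

(* A sequence of near-minimizers in a decreasing sequence of convex sets is
   Cauchy by the parallelogram law. *)
Lemma min_norm_limit (K : nat -> set (H * H)) (M : R) :
    (forall n, exists2 u, K n u & sqnm u <= M) ->
    (forall m n, (n <= m)%N -> K m `<=` K n) ->
    (forall n u v, K n u -> K n v -> K n (2^-1%:C *: (u + v))) ->
  exists2 w, forall n, closure (K n) w &
    forall v, (forall n, K n v) -> sqnm w <= sqnm v.
Proof.
move=> K_M K_dec K_conv.
pose d n := inf (sqnm @` K n).
have Kinf n : has_inf (sqnm @` K n).
  have [u Ku _] := K_M n; split; first by exists (sqnm u), u.
  by exists 0 => _ [v _ <-]; exact: sqnm_ge0.
have d_le n u : K n u -> d n <= sqnm u.
  by move=> Ku; apply: ge_inf; [case: (Kinf n)|exists u].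
have d_mono m n : (n <= m)%N -> d n <= d m.
  move=> nm; apply: lb_le_inf; first by case: (Kinf m).
  by move=> _ [u Ku <-]; apply: d_le; exact: K_dec Ku.
have hsup : has_sup (range d).
  split; first by exists (d 0%N), 0%N.
  by exists M => _ [n _ <-]; have [u /d_le du /(le_trans du)] := K_M n.
pose D := sup (range d).
have dD n : d n <= D by apply: ub_le_sup; [case: hsup|exists n].
have /choice[u u_] n : exists u, K n u /\ sqnm u < d n + n.+1%:R^-1.
  have [|_ [u Ku <-] ud] := inf_adherent _ (Kinf n) (eps := n.+1%:R^-1).
    by rewrite invr_gt0.
  by exists u.
(* The midpoint of [u n] and [u m] lies in [K n], so its squared norm is at least [d n]; the
   parallelogram law turns this into a bound on the difference. *)
have u_dist m n : (n <= m)%N ->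
    sqnm (u n - u m) < 2 * (D - d n) + 4 * n.+1%:R^-1.
  move=> nm.
  have Kn : K n (2^-1%:C *: (u n + u m)).
    by apply: K_conv; [exact: (u_ n).1|exact: K_dec (u_ m).1].
  have := d_le _ _ Kn; rewrite sqnmZr ?invr_ge0//.
  have := parallelogram2 (u n) (u m); have := (u_ n).2; have := (u_ m).2.
  have := dD m; have := d_mono _ _ nm.
  have : m.+1%:R^-1 <= n.+1%:R^-1 :> R by rewrite lef_pV2 ?posrE// ler_nat.
  by move: (m.+1%:R^-1) (n.+1%:R^-1) => *; lra.
have u_cauchy (e : R) : 0 < e -> exists N, forall n, (N <= n)%N ->
    nm (u N - u n).1 < e /\ nm (u N - u n).2 < e.
  move=> e0; have e20 : 0 < e ^+ 2 / 8 by rewrite divr_gt0// exprn_gt0.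
  (* With both [D - d n] and [n.+1%:R^-1] below [e ^+ 2 / 8], the bound of [u_dist] is below
     [6 / 8 * e ^+ 2]. *)
  have [N1 N1_] := small_inv_nat e20.
  have [_ [N2 _ <-] N2_] := sup_adherent e20 hsup.
  exists (maxn N1 N2) => n Nn; apply: sqnm_lt => //.
  apply: lt_trans (u_dist _ _ Nn) _; have := N1_ _ (leq_maxl N1 N2).
  have := d_mono _ _ (leq_maxr N1 N2).
  by move: N2_ (_.+1%:R^-1); rewrite -/D => *; lra.
have [|x /cvg_nm xu] := cauchy_nm_cvg (fst \o u).
  by move=> e /u_cauchy[N N_]; exists N => n /N_[].
have [|y /cvg_nm yu] := cauchy_nm_cvg (snd \o u).
  by move=> e /u_cauchy[N N_]; exists N => n /N_[].
have xyu N (e : R) : 0 < e -> exists n,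
    [/\ (N <= n)%N, nm (x - (u n).1) < e & nm (y - (u n).2) < e].
  move=> e0; have [N1 N1_] := xu _ e0; have [N2 N2_] := yu _ e0.
  exists (maxn N (maxn N1 N2)); split; rewrite ?leq_maxl//.
  - by apply: N1_; rewrite !leq_max leqnn orbT.
  - by apply: N2_; rewrite !leq_max leqnn !orbT.
exists (x, y) => [n|v Kv].
  apply/closure_nm2 => e /(xyu n)[m [nm xm ym]].
  by exists (u m) => //; apply: K_dec nm _ _; exact: (u_ m).1.
(* The 1 pays for the near-minimality error of [u n]. The rest comes from expanding the squares of
   [nm (u n).1 + e] and [nm (u n).2 + e], where these norms are at most [nm x + 1] and [nm y + 1],
   and [e * e <= e]. *)
apply: (ler_add_small_multiple _ _ (1 + 2 * nm x + 2 * nm y + 6)) => e e0 e1.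
have [N N_] := small_inv_nat e0; have [n [Nn xn yn]] := xyu N _ e0.
have := N_ _ Nn; have := (u_ n).2; have := d_le _ _ (Kv n).
have := nm_distD x (u n).1 0; have := nm_distD y (u n).2 0.
have := nm_distD (u n).1 x 0; have := nm_distD (u n).2 y 0.
rewrite !subr0 (nm_distC _ x) (nm_distC _ y).
have := nm_ge0 (u n).1; have := nm_ge0 (u n).2.
have := nm_ge0 x; have := nm_ge0 y.
move: xn yn; rewrite /sqnm/=.
move: (nm (x - _)) (nm (y - _)) (nm x) (nm y) (nm (u n).1) (nm (u n).2).
move=> p q a b c g pe qe b0 a0 g0 c0 h1 h2 h3 h4 h5 h6 h7.
have ac : a ^+ 2 <= (c + e) ^+ 2 by rewrite ler_sqr ?nnegrE; lra.
have bg : b ^+ 2 <= (g + e) ^+ 2 by rewrite ler_sqr ?nnegrE; lra.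
have ce : c * e <= (a + 1) * e by rewrite ler_wpM2r; lra.
have ge : g * e <= (b + 1) * e by rewrite ler_wpM2r; lra.
have ee : e * e <= e by rewrite ger_pMl.
by move: (n.+1%:R^-1) h6 h7 => *; lra.
Qed.

(* The near-fibers [u \in G, |u.1 - z| <= 1 / n, |u.2| <= M] are convex, so
   their near-minimal elements converge. *)
Lemma bounded_fiber_closed (G : set (H * H)) z (M : R) :
    linear_subspace G -> closed G -> 0 <= M ->
    (forall e : R, 0 < e ->
      exists u, [/\ G u, nm (z - u.1) < e & nm u.2 <= M]) ->
  exists2 y, G (z, y) & nm y <= M.
Proof.
move=> [G0 GP] Gc M0 Gz.
pose K n := [set u | [/\ G u, nm (z - u.1) <= n.+1%:R^-1 & nm u.2 <= M]].
have GZ a u : G u -> G (a *: u) by move=> Gu; rewrite -[_ *: _]addr0; exact: GP.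
have h0 : 0 <= (2^-1 : R) by rewrite invr_ge0.
have [|||w Kw _] := min_norm_limit K ((nm z + 1) ^+ 2 + M ^+ 2).
- move=> n; have [|u [Gu zu uM]] := Gz n.+1%:R^-1; first by rewrite invr_gt0.
  exists u; first by split => //; exact: ltW.
  have := nm_distD u.1 z 0; rewrite !subr0 nm_distC => uz.
  have zu1 : nm (z - u.1) < 1.
    by rewrite (lt_le_trans zu)// invf_le1// ler1n.
  have := nm_ge0 u.1; have := nm_ge0 u.2; have := nm_ge0 z.
  by rewrite /sqnm => *; apply: lerD; rewrite ler_sqr ?nnegrE//; lra.
- move=> m n nm u [Gu zu uM]; split => //; rewrite (le_trans zu)//.
  by rewrite lef_pV2 ?posrE// ler_nat.
- move=> n u v [Gu zu uM] [Gv zv vM]; split.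
  + by apply: GZ; rewrite -[u]scale1r; exact: GP.
  + have -> : z - (2^-1%:C *: (u + v)).1 =
        2^-1%:C *: (z - u.1) + 2^-1%:C *: (z - v.1).
      rewrite /= !scalerBr addrACA -scalerDl half_complex scale1r.
      by rewrite scalerDr opprD.
    rewrite (le_trans (nmD _ _))// !nmZr//.
    by move: (n.+1%:R^-1) zu zv => *; lra.
  + rewrite /= nmZr//; have := nmD u.2 v.2; lra.
have Gw : G w.
  apply: closed_nm2 => // e e0.
  by have /closure_nm2/(_ _ e0)[v [Gv _ _] vw] := Kw 0%N; exists v.
have wz : nm (z - w.1) <= 0.
  apply/ler_addgt0Pl => e e0; rewrite addr0.
  have e20 : 0 < e / 2 by rewrite divr_gt0.
  have [N /(_ N (leqnn _))N_] := small_inv_nat e20.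
  have /closure_nm2/(_ _ e20)[v [_ zv _] [wv _]] := Kw N.
  have := le_lt_trans zv N_; have := nm_distD z v.1 w.1.
  by rewrite (nm_distC v.1) => *; lra.
exists w.2.
  have /eqP : z - w.1 = 0 by apply: nm_eq0; apply/le_anti; rewrite wz nm_ge0.
  by rewrite subr_eq0 => /eqP ->; case: (w) Gw.
apply/ler_addgt0Pl => e e0.
have /closure_nm2/(_ _ e0)[v [_ _ vM] [_ wv]] := Kw 0%N.
by have := nm_distD w.2 v.2 0; rewrite !subr0; lra.
Qed.

End ProductNorm.

(** Baire's theorem: if no [F n] contained a ball, one could choose nested balls, the n-th choice
    avoiding [F n], and their centers would converge to a point outside every [F n]. *)
Lemma baire_closed_cover {R : realType} {V : completeNormedModType R[i]}
    (F : nat -> set V) :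
    (forall n, closed (F n)) -> (forall x, exists n, F n x) ->
  exists n x, exists2 r : R, 0 < r & forall y, nm (x - y) < r -> F n y.
Proof.
move=> Fcl Fcov; apply: contrapT => noball.
have step n x (r : R) : exists ys : V * R, 0 < r ->
    [/\ 0 < ys.2, ys.2 <= n.+1%:R^-1, nm (x - ys.1) + ys.2 <= r &
     forall z, nm (ys.1 - z) <= ys.2 -> ~ F n z].
  have [r0|] := pselect (0 < r); last by exists (x, r).
  have [y xy nFy] : exists2 y, nm (x - y) < r & ~ F n y.
    apply: contrapT => nb; apply: noball; exists n, x, r => // y xy.
    by apply: contrapT => nFy; apply: nb; exists y.
  have [e e0 eF] : exists2 e : R, 0 < e & forall z, nm (y - z) < e -> ~ F n z.
    apply: contrapT => ne; apply: nFy; apply: closed_nm => // e e0.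
    apply: contrapT => nz; apply: ne; exists e => // z yz Fz.
    by apply: nz; exists z.
  (* The three bounds make the closed ball avoid [F n], the radii tend to 0, and the new ball stay
     inside the old one. *)
  pose s := Num.min (e / 2) (Num.min n.+1%:R^-1 (r - nm (x - y))).
  exists (y, s) => _ /=.
  have s1 : s <= e / 2 by rewrite ge_min lexx.
  have s2 : s <= n.+1%:R^-1 by rewrite !ge_min lexx orbT.
  have s3 : s <= r - nm (x - y) by rewrite !ge_min lexx !orbT.
  split => //; [|lra|move=> z yz; apply: eF; lra].
  by rewrite !lt_min divr_gt0//= invr_gt0 ltr0Sn subr_gt0.
have /choice[f f_] : forall p : nat * (V * R), exists ys : V * R, 0 < p.2.2 ->
    [/\ 0 < ys.2, ys.2 <= p.1.+1%:R^-1, nm (p.2.1 - ys.1) + ys.2 <= p.2.2 &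
     forall z, nm (ys.1 - z) <= ys.2 -> ~ F p.1 z].
  by move=> p; exact: step.
pose fix b n := if n is k.+1 then f (k, b k) else (0, 1) : V * R.
have b0 n : 0 < (b n).2 by elim: n => [|n /(f_ (n, _))[]//]; exact: ltr01.
have bS n := f_ (n, b n) (b0 n).
have b_dist m n : (n <= m)%N -> nm ((b n).1 - (b m).1) + (b m).2 <= (b n).2.
  elim: m => [|m IH].
    by rewrite leqn0 => /eqP ->; rewrite subrr nm0 add0r.
  rewrite leq_eqVlt => /predU1P[->|]; first by rewrite subrr nm0 add0r.
  rewrite ltnS => /IH h; have [_ _ h' _] := bS m.
  by have := nm_distD (b n).1 (b m).1 (b m.+1).1; rewrite /= in h' *; lra.
have [|x /cvg_nm bx] := cauchy_nm_cvg (fst \o b).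
  move=> e e0; have [N N_] := small_inv_nat e0; exists N.+1 => n Nn.
  have := b_dist _ _ Nn; have := b0 n; have [_ + _ _] := bS N.
  by move=> /le_lt_trans/(_ (N_ _ (leqnn N))) /=; lra.
have bxn n : nm ((b n).1 - x) <= (b n).2.
  apply/ler_addgt0Pl => e e0; have [N N_] := bx _ e0.
  have := N_ _ (leq_maxl N n); have := b_dist _ _ (leq_maxr N n).
  have := b0 (maxn N n).
  have := nm_distD (b n).1 (b (maxn N n)).1 x; rewrite /= (nm_distC x); lra.
have [n Fnx] := Fcov x; have [_ _ _ /(_ x)] := bS n.
by apply => //; exact: (bxn n.+1).
Qed.

(** * Orthogonal projections *)

Section LinearMaps.
Context {K : numFieldType} {V W : normedModType K} {T : V -> W}.
Hypothesis Tlin : linear T.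

Lemma lin0 : T 0 = 0.
Proof. by have := Tlin (-1) 0 0; rewrite scaler0 addr0 scaleN1r addNr. Qed.

Lemma linD x y : T (x + y) = T x + T y.
Proof. by rewrite -[x]scale1r Tlin !scale1r. Qed.

Lemma linZ a x : T (a *: x) = a *: T x.
Proof. by rewrite -[a *: x]addr0 Tlin lin0 addr0. Qed.

Lemma linN x : T (- x) = - T x.
Proof. by rewrite -scaleN1r linZ scaleN1r. Qed.

Lemma linB x y : T (x - y) = T x - T y.
Proof. by rewrite linD linN. Qed.

End LinearMaps.

Lemma linear_nm_continuous {R : realType} {V W : normedModType R[i]}
    (T : V -> W) (C : R) :
  linear T -> (forall x, nm (T x) <= C * nm x) -> continuous T.
Proof.
move=> Tlin TC x B /nbhs_nm[e e0 B_]; apply/nbhs_nm.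
have C0 : 0 < `|C| + 1 by rewrite ltr_wpDl.
exists (e / (`|C| + 1)) => [|y]; first by rewrite divr_gt0.
rewrite ltr_pdivlMr// => xy; apply: B_; rewrite -linB// (le_lt_trans (TC _))//.
apply: le_lt_trans xy; rewrite mulrC ler_wpM2l ?nm_ge0//.
by rewrite (le_trans (ler_norm _))// lerDl.
Qed.

Section Subspaces.
Context {K : numFieldType} {V : normedModType K} {M : set V}.
Hypothesis Msub : linear_subspace M.

Lemma subspace0 : M 0.
Proof. by case: Msub. Qed.

Lemma subspaceZ a x : M x -> M (a *: x).
Proof.
by case: Msub => M0 MP Mx; rewrite -[_ *: _]addr0; exact: MP.
Qed.

Lemma subspaceD x y : M x -> M y -> M (x + y).
Proof. by case: Msub => M0 MP Mx; rewrite -[x]scale1r; exact: MP. Qed.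

Lemma subspaceB x y : M x -> M y -> M (x - y).
Proof.
by move=> Mx My; apply: subspaceD; rewrite // -scaleN1r; exact: subspaceZ.
Qed.

End Subspaces.

Section Inner2.
Context {R : realType} {H : hilbertType R}.
Implicit Types (u v w : H * H) (a : R[i]).

Lemma inner2Dl u v w : inner2 (u + v) w = inner2 u w + inner2 v w.
Proof. by rewrite /inner2 !linearDl addrACA. Qed.

Lemma inner2Zl a u v : inner2 (a *: u) v = a * inner2 u v.
Proof. by rewrite /inner2 !linearZl_LR mulrDr. Qed.

Lemma inner2Bl u v w : inner2 (u - v) w = inner2 u w - inner2 v w.
Proof. by rewrite inner2Dl -scaleN1r inner2Zl mulN1r. Qed.

Lemma inner2C u v : inner2 u v = (inner2 v u)^*.
Proof. by rewrite /inner2 rmorphD/= -!innerC. Qed.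

Lemma inner2Br u v w : inner2 w (u - v) = inner2 w u - inner2 w v.
Proof. by rewrite inner2C inner2Bl rmorphB/= -!inner2C. Qed.

Lemma inner2Zr a u v : inner2 v (a *: u) = a^* * inner2 v u.
Proof. by rewrite inner2C inner2Zl rmorphM/= -inner2C. Qed.

Lemma inner2_eq0 u : inner2 u u = 0 -> u = 0.
Proof.
move=> uu; have /andP[+ _] := norm_inner2 u; rewrite uu => u0.
(* The inserted [true] matches the condition [0 < 2] in [expf_eq0]. *)
apply/eqP; rewrite -normr_eq0 -[_ == _]andTb -(expf_eq0 _ 2).
by rewrite eq_le u0 exprn_ge0.
Qed.

Lemma inner2_inj u v : (forall w, inner2 u w = inner2 v w) -> u = v.
Proof.
move=> uv; apply/eqP; rewrite -subr_eq0; apply/eqP/inner2_eq0.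
by rewrite inner2Bl uv subrr.
Qed.

(** The element [w] of least norm in the coset [u - M] is orthogonal to [M], so [u - w] is the
    projection of [u]. *)
Lemma orthogonal_projection (M : set (H * H)) :
    linear_subspace M -> closed M ->
  exists2 P : H * H -> H * H, projection2 P & range P = M.
Proof.
move=> Msub Mcl.
have MD := subspaceD Msub; have MZ := subspaceZ Msub.
have MB := subspaceB Msub.
pose perp u p := M p /\ forall m, M m -> inner2 (u - p) m = 0.
have perp_ex u : exists p, perp u p.
  have [|||w wcl wmin] :=
      min_norm_limit (fun=> [set u - m | m in M]) (sqnm u).
  - by move=> _; exists u => //; exists 0; rewrite ?subr0//; exact: subspace0.
  - by move=> ? ? _ ?.
  - move=> _ _ _ [m Mm <-] [m' Mm' <-].
    exists (2^-1%:C *: (m + m')); first exact/MZ/MD.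
    rewrite addrACA -opprD scalerBr; congr (_ - _).
    by rewrite scalerDr -scalerDl half_complex scale1r.
  have Muw : M (u - w).
    have swap (a b c : H) : nm (a - b - c) = nm (b - (a - c)).
      by rewrite [RHS]nm_distC addrAC.
    apply: closed_nm2 => // e e0.
    have /closure_nm2/(_ e e0)[_ [m Mm <-] wm] := wcl 0%N.
    by exists m => //; rewrite !swap.
  exists (u - w); split=> // m Mm; rewrite subKr.
  have [->|m0] := eqVneq m 0.
    by rewrite /inner2/= !linear0r addr0.
  pose b := inner2 m m; pose a := inner2 w m.
  have b0 : 0 < b.
    rewrite lt_def /b inner2_sqnm lecR sqnm_ge0 andbT -inner2_sqnm.
    by apply: contra_neq m0; exact: inner2_eq0.
  have bJ : b^* = b by rewrite /b -inner2C.
  have [m' Mm' wE] : exists2 m', M m' & w - (a / b) *: m = u - m'.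
    exists (u - w + (a / b) *: m).
      by apply: MD => //; exact: MZ.
    by rewrite opprD addrA subKr.
  (* Removing from [w] its component along [m] stays in the coset and lowers the squared norm by
     [a * a^* / b]; minimality forces [a = 0]. *)
  have : inner2 w w <= inner2 (w - (a / b) *: m) (w - (a / b) *: m).
    by rewrite !inner2_sqnm lecR; apply: wmin => _; rewrite wE; exists m'.
  rewrite inner2Bl !inner2Br !inner2Zl !inner2Zr -/a -/b (inner2C m w) -/a.
  rewrite rmorphM/= fmorphV/= bJ divfK ?gt_eqF// => h.
  have : a * a^* / b <= 0.
    rewrite -subr_ge0; move: h; rewrite -subr_ge0; apply: etrans.
    by congr (0 <= _); field; rewrite gt_eqF.
  rewrite pmulr_lle0 ?invr_gt0// -sqr_normc => a0.
  apply/eqP; rewrite -normr_eq0 -[_ == _]andTb -(expf_eq0 _ 2).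
  by rewrite eq_le a0 exprn_ge0.
pose P u := xget 0 (perp u).
have P_ u : perp u (P u) by apply: xgetPex; exact: perp_ex.
have P_uniq u p : perp u p -> P u = p.
  move=> [Mp pM]; have [Mu uM] := P_ u.
  apply/eqP; rewrite -subr_eq0; apply/eqP.
  have E : P u - p = (u - p) - (u - P u).
    by rewrite opprB [RHS]addrC addrA subrK.
  apply: inner2_eq0; rewrite {1}E inner2Bl pM ?uM ?subrr//; exact: MB.
have PM m : M m -> P m = m.
  move=> Mm; apply: P_uniq; split=> // n _.
  by rewrite subrr /inner2/= !linear0l addr0.
have Plin : linear P.
  move=> a u v; apply: P_uniq; have [Mu uM] := P_ u; have [Mv vM] := P_ v.
  split=> [|m Mm]; first by apply: MD => //; exact: MZ.
  by rewrite opprD addrACA -scalerBr inner2Dl inner2Zl uM// vM// mulr0 addr0.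
have PP u v : inner2 (P u) v = inner2 (P u) (P v).
  apply/eqP; rewrite -subr_eq0 -inner2Br inner2C (P_ v).2 ?rmorph0//.
  exact: (P_ u).1.
exists P; last first.
  apply/seteqP; split=> [_ [u _ <-]|m Mm]; first exact: (P_ u).1.
  by exists m => //; exact: PM.
split.
(* [P] is a contraction for [inner2]; the factor 2 accounts for passing to the max norm by
   [norm_inner2]. *)
- split=> //; apply: (linear_nm_continuous _ 2) => // u.
  have PPu : inner2 (P u) (P u) <= inner2 u u.
    have := sqnm_ge0 (u - P u); rewrite -lecR -inner2_sqnm.
    rewrite inner2Br ((P_ u).2 _ (P_ u).1) subr0.
    by rewrite inner2Bl PP subr_ge0.
  have /andP[h1 _] := norm_inner2 (P u); have /andP[_ h2] := norm_inner2 u.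
  have : `|P u| ^+ 2 <= (2 * `|u|) ^+ 2.
    rewrite (le_trans h1)// (le_trans PPu)// (le_trans h2)// exprMn.
    by rewrite ler_wpM2r ?exprn_ge0// expr2 ler_peMl// ler1n.
  rewrite ler_sqr ?nnegrE ?mulr_ge0// !nmE.
  by rewrite -(rmorph_nat (real_complex R))/= -rmorphM/= lecR.
- by apply/funext => u; apply: PM; exact: (P_ u).1.
- by move=> u v; rewrite PP inner2C -PP -inner2C.
Qed.

End Inner2.

(** * Invariant subspaces of the ampliation *)

Lemma dense_closure {T : topologicalType} (D : set T) :
  dense D <-> closure D = setT.
Proof.
split=> [Dd|Dcl B [x Bx] Bo].
  apply/seteqP; split=> // x _ B /nbhs_interior Bx.
  have [|y [By Dy]] := Dd _ _ (open_interior B).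
    by exists x; exact: nbhs_singleton.
  by exists y; split => //; exact: interior_subset.
have Dx : closure D x by rewrite Dcl.
have [|y [Dy By]] := Dx B; first by apply: open_nbhs_nbhs; split.
by exists y.
Qed.

Lemma closure_Lat {R : realType} {V : normedModType R[i]} (F : set (V -> V))
    (D : set V) :
  F `<=` bounded_operators V -> linear_subspace D ->
  (forall T, F T -> forall x, D x -> D (T x)) -> Lat F (closure D).
Proof.
move=> Fb Dsub FD; split.
- split=> [|a x y /closure_nm Dx /closure_nm Dy].
    exact/subset_closure/subspace0.
  apply/closure_nm => e e0; have a0 : 0 < nm a + 1 by rewrite ltr_wpDl// nm_ge0.
  have e2 : 0 < e / 2 by rewrite divr_gt0.
  have [x' Dx' xx'] := Dx _ (divr_gt0 e2 a0).
  have [y' Dy' yy'] := Dy _ e2.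
  exists (a *: x' + y'); first exact: Dsub.2.
  rewrite opprD addrACA -scalerBr (le_lt_trans (nmD _ _))// nmZ.
  move: xx'; rewrite ltr_pdivlMr// => xx'.
  by have := nm_ge0 (x - x'); have := nm_ge0 a; nra.
- exact: closed_closure.
- move=> T FT x Dx B TxB; have [_ Tc] := Fb _ FT.
  have [y [Dy By]] := Dx _ (Tc x _ TxB).
  by exists (T y); split=> //; exact: FD.
Qed.

Section Ampliation.
Context {R : realType} {H : hilbertType R}.
Implicit Types (x y z w : H) (A : set (H -> H)) (S : unbounded_operator H).

Lemma ampliation2_bounded : 
  ampliation2 @` bounded_operators H `<=` bounded_operators (H * H)%type.
Proof.
move=> _ [T [Tlin Tc] <-]; split=> [a u v|u].
  by rewrite /ampliation2/= !Tlin.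
apply: cvg_pair; apply: continuous_comp; try exact: Tc.
  exact: cvg_fst.
exact: cvg_snd.
Qed.

Definition rank1 z w : H -> H := fun x => inner x w *: z.

Lemma rank1_bounded z w : bounded_operators H (rank1 z w).
Proof.
have lin : linear (rank1 z w).
  by move=> a x y; rewrite /rank1 linearPl/= scalerDl scalerA.
split=> //; apply: (linear_nm_continuous _ (nm z * nm w)) => // x.
rewrite nmZ mulrC -mulrA ler_wpM2l ?nm_ge0// mulrC; exact: nm_inner_le.
Qed.

Definition graph S : set (H * H) := [set (x, fn S x) | x in dom S].

Lemma graphE S x y : graph S (x, y) <-> dom S x /\ y = fn S x.
Proof. by split=> [[x' Sx [<- <-]]|[Sx ->]]; [|exists x]. Qed.

Lemma graph_subspace S : linear_subspace (graph S).
Proof.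
have [S0 SP] := dom_subspace S; split.
  exists 0 => //; congr pair.
  have := fn_linear (-1) S0 S0.
  by rewrite scaler0 addr0 scaleN1r addNr.
move=> a _ _ [x Sx <-] [y Sy <-]; exists (a *: x + y); first exact: SP.
by rewrite fn_linear.
Qed.

Lemma operator_of_graph (G : set (H * H)) :
  linear_subspace G -> (forall z, G (0, z) -> z = 0) ->
  exists S, graph S = G.
Proof.
move=> Gsub G0.
have Guniq x y z : G (x, y) -> G (x, z) -> y = z.
  move=> Gy Gz; apply/eqP; rewrite -subr_eq0; apply/eqP/G0.
  by rewrite -(subrr x); exact: subspaceB Gy Gz.
pose D := [set x | exists y, G (x, y)].
(* [f x] is the unique [y] above [x], with default 0 outside [D]. *)
pose f x := xget 0 [set y | G (x, y)].
have Gf x : D x -> G (x, f x) by move=> Dx; exact: (xgetPex 0 Dx).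
have Dsub : linear_subspace D.
  split=> [|a x y [x' Gx] [y' Gy]]; first by exists 0; exact: (subspace0 Gsub).
  by exists (a *: x' + y'); exact: (Gsub.2 a _ _ Gx Gy).
have flin (a : R[i]) x y : D x -> D y -> f (a *: x + y) = a *: f x + f y.
  move=> Dx Dy; apply: (Guniq (a *: x + y)).
    by apply: Gf; exact: Dsub.2.
  exact: (Gsub.2 a _ _ (Gf _ Dx) (Gf _ Dy)).
exists (UnboundedOperator Dsub flin).
apply/seteqP; split=> [_ [x Dx <-]|[x y] G_]; first exact: Gf.
have Dx : D x by exists y.
by exists x => //=; congr pair; apply: Guniq G_; exact: Gf.
Qed.

Lemma graph_invariant A S :
  (forall T, A T -> commutes_with T S) <->
  (forall T, (ampliation2 @` A) T -> forall u, graph S u -> graph S (T u)).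
Proof.
split=> [AS _ [T AT <-] _ [x Sx <-]|AS T AT x Sx].
  by apply/graphE; have [? ?] := AS T AT x Sx.
apply/graphE; apply: (AS (ampliation2 T) _ (x, fn S x)); first by exists T.
by exists x.
Qed.

Lemma not_lin_indep2 x y : x != 0 -> ~ lin_indep2 x y ->
  exists c : R[i], y = c *: x.
Proof.
move=> x0 xy; apply: contrapT => nc; apply: xy => a b abxy.
have [b0|b0] := eqVneq b 0.
  move: abxy; rewrite b0 scale0r addr0 => /eqP.
  by rewrite scaler_eq0 (negPf x0) orbF => /eqP.
exfalso; apply: nc; exists (- (b^-1 * a)).
apply/eqP; rewrite scaleNr -addr_eq0 addrC -scalerA -[y](scalerK b0).
by rewrite -scalerDr abxy scaler0.
Qed.

(** This splits off the zero space, where there is no nonzero vector on which to use transitivity or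
    divide by [inner x x]. *)
Lemma dense_nonzero (D : set H) :
  dense D -> (exists2 x, D x & x != 0) \/ (forall x : H, x = 0).
Proof.
move=> /dense_closure Dd.
have [[x x0]|H0] := pselect (exists x : H, x != 0); [left|right] => [|x].
  have /closure_nm/(_ _ (nm_gt0 _ x0))[y Dy xy] : closure D x by rewrite Dd.
  by exists y => //; apply: contraTneq xy => ->; rewrite subr0 ltxx.
by apply: contrapT => /eqP x0; apply: H0; exists x.
Qed.

Lemma is_scalar_trivial S : (forall x : H, x = 0) -> is_scalar S.
Proof.
move=> H0; exists 0; split=> [|x]; last by rewrite (H0 (fn S x)) scale0r.
apply/seteqP; split=> // x _; rewrite (H0 x).
exact: subspace0 (dom_subspace S).
Qed.

Definition scalar_commutant A := forall S, dense (dom S) -> closed_operator S ->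
  (forall T, A T -> commutes_with T S) -> is_scalar S.

Definition bounded_approximation A := forall x y z, x != 0 ->
  exists T : nat -> H -> H,
  [/\ forall n, A (T n), (fun n => T n x) @ \oo --> z &
    exists M : R[i], forall n, `|T n y| <= M].

End Ampliation.

(** * Implications between the conditions, apart from (3) => (2) *)

Section Transitive.
Context {R : realType} {H : hilbertType R} (A : set (H -> H)).
Hypothesis hA : transitive_algebra A.
Implicit Types (x y z w : H) (S : unbounded_operator H).

Let A_bounded T : A T -> bounded_operators H T.
Proof. by case: hA => -[+ _ _ _] _ _; exact. Qed.

Let A_linear T : A T -> linear T.
Proof. by move=> /A_bounded[]. Qed.

Let A_id : A id.
Proof. by case: hA. Qed.

Let ampA_bounded :
  ampliation2 @` A `<=` bounded_operators (H * H)%type.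
Proof.
move=> _ [T AT <-]; apply: ampliation2_bounded.
by exists T => //; exact: A_bounded.
Qed.

Lemma transitive_Lat M x : Lat A M -> M x -> x != 0 -> M = setT.
Proof.
case: hA => _ _ AL /AL[->|//] ->; by rewrite eqxx.
Qed.

Lemma transitive_orbit x : x != 0 -> closure [set T x | T in A] = setT.
Proof.
case: hA => -[_ A0 AD AM] _ _ x0; apply: (transitive_Lat _ x) => //.
  apply: closure_Lat => //.
    split=> [|a _ _ [T AT <-] [S AS <-]]; first by exists (cst 0).
    by exists (fun x => a *: T x + S x); first exact: AD.
  by move=> T AT _ [S AS <-]; exists (T \o S) => //; exact: AM.
by apply: subset_closure; exists id.
Qed.

Lemma orbit2_Lat x y :
  Lat (ampliation2 @` A) (closure [set (T x, T y) | T in A]).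
Proof.
case: hA => -[_ A0 AD AM] _ _; apply: closure_Lat => //.
  split=> [|a _ _ [T AT <-] [S AS <-]]; first by exists (cst 0).
  by exists (fun x => a *: T x + S x); first exact: AD.
move=> _ [T AT <-] _ [S AS <-]; exists (T \o S) => //; exact: AM.
Qed.

(** If [x] and [S x] were independent, the closed graph would contain every [(0, z)], so [H] would
    be zero. Otherwise every vector of the domain is an eigenvector, linearity makes the eigenvalues
    agree, and density with closedness extends the formula to [H]. *)
Lemma two_fold_scalar_commutant : two_fold_transitive A -> scalar_commutant A.
Proof.
move=> A2 S /dense_closure Sd Sc SA.
have [ind|] := pselect (exists2 x, dom S x & lin_indep2 x (fn S x)).
  have [x Sx /A2 xSx] := ind.
  apply: is_scalar_trivial => z.
  have /Sc/graphE[_ ->] : closure (graph S) (0, z).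
    suff : closure [set (T x, T (fn S x)) | T in A] (0, z).
      apply: closure_subset => _ [T AT <-]; apply/graphE.
      by have [] := SA T AT x Sx.
    by rewrite xSx.
  by have [_ /esym] := (graphE S 0 0).1 (subspace0 (graph_subspace S)).
move=> nind.
have S00 : fn S 0 = 0.
  by have [_ /esym] := (graphE S 0 0).1 (subspace0 (graph_subspace S)).
have Seig x : dom S x -> exists c : R[i], fn S x = c *: x.
  move=> Sx; have [->|x0] := eqVneq x 0.
    by exists 0; rewrite scale0r.
  by apply: not_lin_indep2 => // ind; apply: nind; exists x.
have [l Sl] : exists l : R[i], forall x, dom S x -> fn S x = l *: x.
  have [[x Sx x0]|all0] := pselect (exists2 x, dom S x & x != 0); last first.
    exists 0 => x Sx; have [c ->] := Seig x Sx.
    have [->|x0] := eqVneq x 0; first by rewrite !scaler0.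
    by exfalso; apply: all0; exists x.
  have [l xl] := Seig _ Sx; exists l => y Sy; have [m ym] := Seig _ Sy.
  have [n xyn] := Seig _ (subspaceD (dom_subspace S) _ _ Sx Sy).
  have : fn S (x + y) = l *: x + m *: y.
    by rewrite -[x in LHS]scale1r fn_linear// xl ym scale1r.
  (* Now [(n - l) *: x + (n - m) *: y = 0]. If [n = l], then [l *: y = m *: y]; otherwise [x] is a
     multiple of [y], hence [y] one of [x], with the same eigenvalue. *)
  rewrite xyn scalerDr => /eqP; rewrite -subr_eq0 opprD addrACA -!scalerBl.
  have [->|nl] := eqVneq n l.
    by rewrite subrr scale0r add0r scalerBl subr_eq0 ym => /eqP.
  rewrite addr_eq0 => /eqP xy.
  have {}xy : x = (- ((n - l)^-1 * (n - m))) *: y.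
    by rewrite scaleNr -scalerA -scalerN -xy scalerK// subr_eq0.
  move: x0; rewrite {1}xy scaler_eq0 => /norP[c0 _].
  have {xy} yE : y = (- ((n - l)^-1 * (n - m)))^-1 *: x.
    by rewrite [in RHS]xy scalerK.
  rewrite yE -[_ *: x]addr0 fn_linear ?S00 ?addr0 ?xl//.
    by rewrite scalerA mulrC -scalerA.
  exact: subspace0 (dom_subspace S).
have Sgr z : graph S (z, l *: z).
  apply: closed_nm2 => // e e0.
  have l0 : 0 < nm l + 1 by rewrite ltr_wpDl// nm_ge0.
  have : closure (dom S) z by rewrite Sd.
  move=> /closure_nm/(_ _ (divr_gt0 e0 l0))[x Sx].
  rewrite ltr_pdivlMr// => zx; exists (x, fn S x); first by exists x.
  rewrite /= Sl// -scalerBr nmZ.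
  by have := nm_ge0 (z - x); have := nm_ge0 l; split; nra.
exists l; split=> [|z]; last by have /graphE[_ ->] := Sgr z.
by apply/seteqP; split=> // z _; have /graphE[] := Sgr z.
Qed.

(** The slices of [M] along the two coordinate axes are invariant under [A]. If the slice
    [{z | M (0, z)}] is all of [H], the other slice decides; if it is zero, [M] is the graph of a
    closed operator, whose domain is zero or dense by transitivity. *)
Lemma Lat_ampliation2 M : scalar_commutant A -> Lat (ampliation2 @` A) M ->
  [\/ M = setT, M = [set u | u.1 = 0], M = [set 0] |
      exists l : R[i], M = [set u | u.2 = l *: u.1]].
Proof.
move=> A2 MLat; have [Msub Mcl MA] := MLat.
have MAT T u : A T -> M u -> M (T u.1, T u.2).
  by move=> AT Mu; apply: (MA (ampliation2 T) _ u Mu); exists T.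
have T0 T : A T -> T 0 = 0 by move=> /A_linear/lin0.
have [[z Mz z0]|M0] := pselect (exists2 z, M (0, z) & z != 0).
  have M2 y : M (0, y).
    suff : [set y | M (0, y)] = setT by move=> /seteqP[_]; exact.
    apply: transitive_Lat Mz z0; split.
    - split=> [|a x w Mx Mw]; first exact: (subspace0 Msub).
      by have := Msub.2 a _ _ Mx Mw; rewrite -[X in M X]/(_, _)/= scaler0 addr0.
    - move=> w /closure_nm wc; apply: closed_nm2 => // e /wc[x Mx wx].
      by exists (0, x) => //=; rewrite subrr nm0 (le_lt_trans _ wx)// nm_ge0.
    - by move=> T AT x Mx; have := MAT _ _ AT Mx; rewrite /= T0.
  (* As [M] contains all [(0, y)], membership depends on the first coordinate only. *)
  have ME u : M u <-> M (u.1, 0).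
    rewrite [u]surjective_pairing/=; split=> Mu.
      have := subspaceB Msub _ _ Mu (M2 u.2).
      by rewrite -[X in M X]/(_, _)/= subr0 subrr.
    have := subspaceD Msub _ _ Mu (M2 u.2).
    by rewrite -[X in M X]/(_, _)/= addr0 add0r.
  have [[x Mx x0]|M1] := pselect (exists2 x, M (x, 0) & x != 0).
    apply: Or41; apply/seteqP; split=> // u _; apply/ME.
    suff : [set x | M (x, 0)] = setT by move=> /seteqP[_]; exact.
    apply: transitive_Lat Mx x0; split.
    - split=> [|a y w My Mw]; first exact: (subspace0 Msub).
      by have := Msub.2 a _ _ My Mw; rewrite -[X in M X]/(_, _)/= scaler0 addr0.
    - move=> y /closure_nm yc; apply: closed_nm2 => // e /yc[w Mw yw].
      exists (w, 0) => //=; split; rewrite // subrr nm0.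
      by rewrite (le_lt_trans _ yw)// nm_ge0.
    - by move=> T AT w Mw; have := MAT _ _ AT Mw; rewrite /= T0.
  apply: Or42; apply/seteqP; split=> [u /ME Mu /=|[x y] /= ->//].
  by apply: contrapT => /eqP u0; apply: M1; exists u.1.
have [|S SM] := operator_of_graph M Msub.
  by move=> z Mz; apply: contrapT => /eqP z0; apply: M0; exists z.
have [[x Sx x0]|D0] := pselect (exists2 x, dom S x & x != 0); last first.
  apply: Or43; rewrite -SM; apply/seteqP; split=> [_ [x Sx <-]|_ ->].
    have x0 : x = 0 by apply: contrapT => /eqP x0; apply: D0; exists x.
    move: (graphE S x (fn S x)).2; rewrite x0 in Sx *.
    have [_ <-//] := (graphE S 0 0).1 (subspace0 (graph_subspace S)).
  exact: subspace0 (graph_subspace S).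
apply: Or44; have [|||l [Sl Sl']] := A2 S.
- apply/dense_closure/(transitive_Lat _ x) => //; last exact: subset_closure.
  apply: closure_Lat; [by []|exact: dom_subspace|] => T AT y Sy.
  by have [] := (graph_invariant A S).2 _ T AT y Sy; rewrite // SM.
- by rewrite /closed_operator -/(graph S) SM.
- by apply/graph_invariant; rewrite SM.
exists l; rewrite -SM; apply/seteqP; split=> [_ [y Sy <-]|[y z] /= ->].
  exact: Sl'.
by apply/graphE; rewrite Sl Sl'.
Qed.

(** The orbit closure contains [(x, y)] because [id] is in [A], and each proper subspace listed in
    [Lat_ampliation2] would impose a linear relation on [x] and [y]. *)
Lemma scalar_commutant_two_fold : scalar_commutant A -> two_fold_transitive A.
Proof.
move=> A2 x y xy; have Mxy : closure [set (T x, T y) | T in A] (x, y).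
  by apply: subset_closure; exists id.
case: (Lat_ampliation2 _ A2 (orbit2_Lat x y)) => // [||[l]] ME.
- move: Mxy; rewrite ME/= => x0; have [|/eqP] := xy 1 0.
    by rewrite x0 scaler0 scale0r addr0.
  by rewrite oner_eq0.
- move: Mxy; rewrite ME/= => -[x0 _]; have [|/eqP] := xy 1 0.
    by rewrite x0 scaler0 scale0r addr0.
  by rewrite oner_eq0.
- move: Mxy; rewrite ME/= => yl; have [|_ /eqP] := xy (- l) 1.
    by rewrite yl scaleNr scale1r addNr.
  by rewrite oner_eq0.
Qed.

Lemma scalar_commutant_Lat : scalar_commutant A ->
  Lat (ampliation2 @` A) = Lat (ampliation2 @` bounded_operators H).
Proof.
move=> A2; apply/seteqP; split=> M MLat; have [Msub Mcl MA] := MLat; split=> //.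
  move=> _ [T [Tlin _] <-] u; have T0 := lin0 Tlin.
  case: (Lat_ampliation2 _ A2 MLat) => [->//|->/=->//|->->|[l ->]/= ->].
    by rewrite /ampliation2/= T0.
  by rewrite linZ.
by move=> _ [T AT <-]; apply: MA; exists T => //; exact: A_bounded.
Qed.

(** The graph of [S] is invariant under [rank1 z x] acting on both coordinates; applied to
    [(x, fn S x)], this gives [(inner x x *: z, inner (fn S x) x *: z)], so [S] multiplies every [z]
    by the same scalar. *)
Lemma Lat_scalar_commutant :
  Lat (ampliation2 @` A) = Lat (ampliation2 @` bounded_operators H) ->
  scalar_commutant A.
Proof.
move=> ALat S Sd Sc SA.
have [GS _ GB] : Lat (ampliation2 @` bounded_operators H) (graph S).
  rewrite -ALat; split; [exact: graph_subspace|exact: Sc|].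
  exact/graph_invariant.
have [[x Sx x_neq0]|] := dense_nonzero _ Sd; last exact: is_scalar_trivial.
have xx0 : inner x x != 0 by rewrite dnorm_eq0.
have Gz z : graph S (z, ((inner x x)^-1 * inner (fn S x) x) *: z).
  have Gx : graph S (x, fn S x) by exists x.
  have BT : (ampliation2 @` bounded_operators H) (ampliation2 (rank1 z x)).
    by exists (rank1 z x) => //; exact: rank1_bounded.
  have := subspaceZ GS (inner x x)^-1 _ (GB _ BT _ Gx).
  by rewrite /ampliation2 /rank1 -[X in graph S X]/(_, _)/= scalerK// scalerA.
exists ((inner x x)^-1 * inner (fn S x) x).
split=> [|z]; last by have /graphE[_ ->] := Gz z.
by apply/seteqP; split=> // z _; have /graphE[] := Gz z.
Qed.

(** For independent [x], [y] one can send [x] near [z] and [y] near 0. If [y = c *: x], then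
    [T n y = c *: T n x] is bounded along with the convergent [T n x]. *)
Lemma two_fold_bounded_approximation :
  two_fold_transitive A -> bounded_approximation A.
Proof.
move=> A2 x y z x0.
have n0 n : 0 < n.+1%:R^-1 :> R by rewrite invr_gt0.
have [ind|/not_lin_indep2] := pselect (lin_indep2 x y).
  have /choice[T T_] n : exists T, A T /\
      (nm (z - T x) < n.+1%:R^-1 /\ nm (T y) < n.+1%:R^-1).
    have : closure [set (T x, T y) | T in A] (z, 0) by rewrite A2.
    move=> /closure_nm2/(_ _ (n0 n))[_ [T AT <-] /=].
    by rewrite sub0r nmN; exists T.
  exists T; split=> [n||]; first exact: (T_ n).1.
    apply/cvg_nm => e /small_inv_nat[N N_]; exists N => n /N_.
    by apply: lt_trans; exact: (T_ n).2.1.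
  exists 1 => n; rewrite nmE -(rmorph1 (real_complex R)) lecR ltW//.
  by rewrite (lt_le_trans (T_ n).2.2)// invf_le1// ler1n.
move=> /(_ x0)[c yE].
have /choice[T T_] n : exists T, A T /\ nm (z - T x) < n.+1%:R^-1.
  have : closure [set T x | T in A] z by rewrite transitive_orbit.
  by move=> /closure_nm/(_ _ (n0 n))[_ [T AT <-] /=]; exists T.
exists T; split=> [n||]; first exact: (T_ n).1.
  apply/cvg_nm => e /small_inv_nat[N N_]; exists N => n /N_.
  by apply: lt_trans; exact: (T_ n).2.
exists (nm c * (nm z + 1))%:C => n; rewrite nmE lecR yE.
rewrite linZ; last exact/A_linear/(T_ n).1.
rewrite nmZ ler_wpM2l ?nm_ge0//; have := nm_distD (T n x) z 0.
rewrite !subr0 (nm_distC _ z) addrC => /le_trans; apply.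
by rewrite lerD2l ltW// (lt_le_trans (T_ n).2)// invf_le1// ler1n.
Qed.

(** The rank-one ampliations are stable under adjoints, so the self-adjoint [P] commutes with them,
    which forces its entries to be scalar. *)
Lemma Lat_projection :
  Lat (ampliation2 @` A) = Lat (ampliation2 @` bounded_operators H) ->
  forall P : H * H -> H * H,
    projection2 P -> Lat (ampliation2 @` A) (range P) ->
    range scalar_operator2 P.
Proof.
move=> -> P Pproj; have [[Plin _] _ Psa] := Pproj.
move=> /(Lat_projection2 _ Pproj) PB.
have [[x x0]|H0] := pselect (exists x : H, x != 0); last first.
  have H0' (z : H) : z = 0 by apply: contrapT => /eqP z0; apply: H0; exists z.
  (* On the zero space all maps coincide, so the zero matrix serves. *)
  exists 0 => //; apply/funext => u; apply/pair_eqP/andP.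
  by split; apply/eqP; rewrite [LHS]H0' [RHS]H0'.
have adj z w u v : inner2 (ampliation2 (rank1 z w) u) v =
    inner2 u (ampliation2 (rank1 w z) v).
  rewrite /inner2 /ampliation2 /rank1/= !linearZl_LR/= !linearZr_LR/=.
  by rewrite -!innerC; congr (_ + _); exact: mulrC.
have PBP z w u :
    P (ampliation2 (rank1 z w) (P u)) = ampliation2 (rank1 z w) (P u).
  have BT : (ampliation2 @` bounded_operators H) (ampliation2 (rank1 z w)).
    by exists (rank1 z w) => //; exact: rank1_bounded.
  exact: (congr1 (@^~ u) (PB _ BT)).
(* With [B] the ampliation of [rank1 z w], the adjoint of [PBP] for [rank1 w z] reads [P B P = P B],
   while [PBP] itself gives [P B P = B P]. *)
have Pcomm z w u :
    P (ampliation2 (rank1 z w) u) = ampliation2 (rank1 z w) (P u).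
  apply: inner2_inj => v.
  by rewrite Psa adj -PBP -Psa -adj -Psa PBP.
have xx0 : inner x x != 0 by rewrite dnorm_eq0.
pose c := (inner x x)^-1.
(* Column [j] of the matrix is read off from [e j] by pairing its two coordinates with [x]. *)
pose e (j : 'I_2) : H * H := if j == 0 then P (x, 0) else P (0, x).
have P1 z : P (z, 0) = (c * inner (e 0).1 x *: z, c * inner (e 0).2 x *: z).
  have := Pcomm z x (x, 0); rewrite /ampliation2/= /rank1 linear0l scale0r.
  move=> /(congr1 (fun u => c *: u)); rewrite -linZ// -[X in P X]/(_, _)/=.
  by rewrite scalerK// scaler0 -[X in _ = X]/(_, _)/= !scalerA.
have P2 z : P (0, z) = (c * inner (e 1).1 x *: z, c * inner (e 1).2 x *: z).
  have := Pcomm z x (0, x); rewrite /ampliation2/= /rank1 linear0l scale0r.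
  move=> /(congr1 (fun u => c *: u)); rewrite -linZ// -[X in P X]/(_, _)/=.
  by rewrite scalerK// scaler0 -[X in _ = X]/(_, _)/= !scalerA.
exists (\matrix_(i, j)
  (c * inner (if i == 0 then (e j).1 else (e j).2) x)) => //.
apply/funext => -[u v].
have -> : (u, v) = (u, 0) + (0, v) by rewrite -[RHS]/(_, _)/= addr0 add0r.
rewrite (linD Plin) P1 P2 /scalar_operator2 !mxE/=.
by rewrite addr0 add0r.
Qed.

(** The orthogonal projection onto [M] is a scalar matrix, hence commutes with every
    [ampliation2 T], so its range [M] is invariant. *)
Lemma projection_Lat :
  (forall P : H * H -> H * H,
    projection2 P -> Lat (ampliation2 @` A) (range P) ->
    range scalar_operator2 P) ->
  Lat (ampliation2 @` A) = Lat (ampliation2 @` bounded_operators H).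
Proof.
move=> AP; apply/seteqP; split=> M MLat; have [Msub Mcl MA] := MLat; split=> //.
  have [P Pproj PM] := orthogonal_projection M Msub Mcl.
  have [|a _ aP] := AP P Pproj; first by rewrite PM.
  move=> _ [T [Tlin _] <-] u; rewrite -PM => -[v _ <-].
  exists (ampliation2 T v) => //.
  by rewrite -aP /scalar_operator2 /ampliation2/= !(linD Tlin, linZ Tlin).
by move=> _ [T AT <-]; apply: MA; exists T => //; exact: A_bounded.
Qed.

End Transitive.

(** * Bounded approximation and the spectrum *)

Lemma bounded_approximation_everywhere {R : realType} {H : hilbertType R}
    (A : set (H -> H)) (G : set (H * H)) (x y : H) :
  bounded_approximation A -> Lat (ampliation2 @` A) G -> G (x, y) -> x != 0 ->
  exists2 C : R, 0 <= C &
    forall z, exists2 w, G (z, w) & nm w <= C * nm z.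
Proof.
move=> A3 [Gsub Gcl GA] Gxy x0.
(* The points [(T n x, T n y)] of [G] approach the fiber over [z] with bounded second coordinates,
   so [bounded_fiber_closed] applies. *)
have Gex z : exists w, G (z, w).
  have [T [AT /cvg_nm Tx [M TM]]] := A3 x y z x0.
  have {}TM n : nm (T n y) <= complex.Re M.
    by have := TM n; rewrite lecE => /andP[].
  have [||w] := bounded_fiber_closed G z (complex.Re M) Gsub Gcl.
  - by rewrite (le_trans _ (TM 0%N))// nm_ge0.
  - move=> e /Tx[N /(_ N (leqnn N)) zT]; exists (T N x, T N y).
    split; [|exact: zT|exact: TM].
    by apply: (GA (ampliation2 (T N)) _ (x, y) Gxy); exists (T N).
  by move=> Gw _; exists w.
pose F n := [set z | exists2 w, G (z, w) & nm w <= n%:R].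
have [|z|n [z [r r0 zF]]] := baire_closed_cover F.
- move=> n z /closure_nm zF; apply: bounded_fiber_closed => // e /zF[z'].
  by move=> [w Gw wn] zz'; exists (z', w).
- have [w Gw] := Gex z; exists (Num.trunc (nm w)).+1; exists w => //.
  exact/ltW/truncnS_gt.
(* Subtracting points of [G] above [z + w] and [z] recenters the ball at 0 and doubles the bound. *)
have near0 w : nm w < r -> exists2 v, G (w, v) & nm v <= 2 * n%:R.
  move=> wr; have [|v Gv vn] := zF (z + w).
    by rewrite opprD addrA subrr add0r nmN.
  have [|v' Gv' vn'] := zF z; first by rewrite subrr nm0.
  exists (v - v'); last by have := nmB v v'; lra.
  have := subspaceB Gsub _ _ Gv Gv'.
  by rewrite -[X in G X]/(_, _)/= (addrC z) addrK.
exists (2 * n%:R * (2 / r)) => [|w]; first by rewrite !mulr_ge0// invr_ge0 ltW.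
have [->|w0] := eqVneq w 0.
  by exists 0; [exact: (subspace0 Gsub)|rewrite !nm0 mulr0].
have w_gt0 := nm_gt0 _ w0.
(* This scales [w] to norm [r / 2], inside the ball; scaling back yields the factor [2 / r]. *)
pose t : R := r / (2 * nm w).
have t0 : 0 < t by rewrite divr_gt0// mulr_gt0.
have [|v Gv vn] := near0 (t%:C *: w).
  rewrite nmZr ?(ltW t0)// /t.
  have -> : r / (2 * nm w) * nm w = r / 2 by field; rewrite gt_eqF.
  lra.
exists (t^-1%:C *: v); last first.
  rewrite nmZr ?invr_ge0 ?(ltW t0)// ler_pdivrMl// (le_trans vn)//.
  rewrite le_eqVlt; apply/orP; left; apply/eqP.
  by rewrite /t; field; rewrite !gt_eqF.
have := subspaceZ Gsub (t^-1%:C) _ Gv.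
by rewrite -[X in G X]/(_, _)/= scalerA -rmorphM/= mulVf ?gt_eqF// scale1r.
Qed.

(** * A bounded operator on a nonzero space has nonempty spectrum *)

Section Spectrum.
Context {R : realType} {H : hilbertType R} (S : H -> H) (C : R).
Hypothesis Slin : linear S.
Hypothesis SC : forall x, nm (S x) <= C * nm x.
Variable B : R[i] -> H -> H.
Hypothesis SB : forall l x, S (B l x) - l *: B l x = x.
Hypothesis BS : forall l x, B l (S x - l *: x) = x.
Hypothesis Bb : forall l,
  exists2 K : R, 0 <= K & forall x, nm (B l x) <= K * nm x.

Let Blin l : linear (B l).
Proof.
move=> a x y; rewrite -[RHS](BS l); congr (B l _).
rewrite Slin scalerDr opprD addrACA scalerA mulrC -scalerA -scalerBr.
by rewrite !SB.
Qed.

Let resolvent_eq l m x : B m x = B l x + (m - l) *: B l (B m x).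
Proof.
rewrite -(linZ (Blin l)) -(linD (Blin l)) -[LHS](BS l); congr (B l _).
by rewrite -[X in _ = X + _](SB m x) scalerBl addrA subrK.
Qed.

Variable x0 : H.
Hypothesis x0_neq0 : x0 != 0.

Let g l := B l x0.

Let g_neq0 l : g l != 0.
Proof.
apply: contra_neq x0_neq0 => gl.
by rewrite -(SB l x0) -/(g l) gl scaler0 (lin0 Slin) subrr.
Qed.

Let g_continuous l (e : R) : 0 < e ->
  exists2 d : R, 0 < d & forall m, nm (l - m) < d -> `|nm (g l) - nm (g m)| < e.
Proof.
move=> e0; have [K K0 BK] := Bb l.
(* For [nm (l - m) < D^-1], the first summand gives [nm (g m) <= 2 * nm (g l)], and the second then
   makes [nm (l - m) * K * nm (g m)] smaller than [e]. *)
pose D := 2 * K + 2 * K * nm (g l) / e + 1.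
have q0 : 0 <= 2 * K * nm (g l) / e.
  by rewrite !mulr_ge0 ?nm_ge0 ?invr_ge0// ltW.
have D0 : 0 < D by rewrite /D; lra.
exists D^-1; first by rewrite invr_gt0.
move=> m; rewrite -[X in _ < X]mul1r ltr_pdivlMr// => lmD.
have gE := resolvent_eq l m x0; rewrite -/(g l) -/(g m) in gE.
have gd : nm (g m - g l) <= nm (l - m) * (K * nm (g m)).
  rewrite {1}gE addrAC subrr add0r nmZ nm_distC ler_wpM2l ?nm_ge0//.
have gd1 := nm_distD (g m) (g l) 0; have gd2 := nm_distD (g l) (g m) 0.
rewrite !subr0 (nm_distC (g l)) in gd1 gd2.
have d0 := nm_ge0 (l - m); have gm0 := nm_ge0 (g m); have gl0 := nm_ge0 (g l).
move: lmD; rewrite /D !mulrDr mulr1 => lmD.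
have h1 : 0 <= nm (l - m) * (2 * K * nm (g l) / e) by rewrite mulr_ge0.
have h2 : nm (l - m) * (2 * K) < 1 by lra.
have h3 : nm (l - m) * (2 * K * nm (g l)) < e.
  have h0 : 0 <= nm (l - m) * (2 * K) by rewrite !mulr_ge0.
  have : nm (l - m) * (2 * K * nm (g l) / e) < 1 by lra.
  by rewrite mulrA ltr_pdivrMr// mul1r.
have h4 : nm (g m) <= 2 * nm (g l).
  have : nm (l - m) * (2 * K) * nm (g m) <= 1 * nm (g m).
    by rewrite ler_wpM2r// ltW.
  by lra.
have h5 : nm (l - m) * K * nm (g m) <= nm (l - m) * K * (2 * nm (g l)).
  by rewrite ler_wpM2l// mulr_ge0.
have h6 : nm (g m - g l) < e by lra.
by rewrite ltr_norml; apply/andP; split; lra.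
Qed.

(** [nm (g m)] is continuous on a compact square of parameters, and outside it is at most its value
    at 0. *)
Let g_max : exists l, forall m, nm (g m) <= nm (g l).
Proof.
pose f (p : R * R) := nm (g (p.1%:C + 'i * p.2%:C)).
have fcont : continuous f.
  move=> p; apply/cvgrPdist_lt => e e0.
  have [d d0 gd] := g_continuous (p.1%:C + 'i * p.2%:C) e e0.
  have d20 : 0 < d / 2 by rewrite divr_gt0.
  apply/(@nbhs_ballP R (R * R)%type); exists (d / 2) => // q [q1 q2].
  apply: gd; rewrite opprD addrACA -mulrBr -!rmorphB/=.
  rewrite (le_lt_trans (nmD _ _))// nmM !nm_real /nm normCi mul1r.
  by move: q1 q2; rewrite /ball/=; lra.
(* From [m *: g m = S (g m) - x0] one gets [(nm m - |C|) * nm (g m) <= nm x0], which is less than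
   [(nm m - |C|) * nm (g 0)] once [nm m > L]. *)
pose L := `|C| + nm x0 / nm (g 0).
have L0 : 0 <= L by rewrite addr_ge0// mulr_ge0 ?invr_ge0 ?nm_ge0.
have LI : (0 : R) \in `[- L, L] by rewrite in_itv/= oppr_le0 L0.
have [|||c _ cmax] := @compact_EVT_max _ R f (`[- L, L] `*` `[- L, L]).
- by exists (0, 0).
- by apply: compact_setX; exact: segment_compact.
- exact: continuous_subspaceT.
exists (c.1%:C + 'i * c.2%:C) => m; rewrite -/(f c).
have [mL|mL] := leP (nm m) L.
  have := cmax (complex.Re m, complex.Im m); rewrite {1}/f/= -complexE; apply.
  rewrite inE; split; rewrite /= in_itv/= -ler_norml (le_trans _ mL)//
    -lecR -nmE.
    exact: normc_ge_Re.
  by rewrite normc_def lecR -sqrtr_sqr ler_wsqrtr// lerDr sqr_ge0.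
have g0 : nm (g 0) <= f c.
  have := cmax (0, 0); rewrite /f/= mulr0 addr0; apply.
  by rewrite inE.
apply: le_trans g0.
have : nm m * nm (g m) <= C * nm (g m) + nm x0.
  have -> : nm m * nm (g m) = nm (S (g m) - x0).
    by rewrite -[X in _ - X](SB m x0) -/(g m) subKr nmZ.
  by rewrite (le_trans (nmB _ _))// lerD2r.
have gm0 := nm_ge0 (g m); have := nm_gt0 _ (g_neq0 0) => g0.
have h : C * nm (g m) <= `|C| * nm (g m) by rewrite ler_wpM2r// ler_norm.
move: mL; rewrite /L -ltrBrDl ltr_pdivrMr// => mL mg.
have mC : 0 < nm m - `|C|.
  by rewrite -(pmulr_lgt0 _ g0) (le_lt_trans _ mL)// nm_ge0.
by rewrite -(ler_pM2l mC); lra.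
Qed.

(* [g] takes its maximal norm [m] at [l]. With [G_j = g (l + i^j t)] and
   [b = B l], the resolvent equation gives [\sum_j G_j = 4 u0 + O(t^4)] and
   [\sum_j i^-j G_j = 4 t u1 + O(t^4)], whereas two uses of the parallelogram
   law bound the sum of the squares of these norms by [4 \sum_j |G_j|^2], hence
   by [16 m^2]. As [|u0| = m] and [u1 != 0], this fails for small [t]. *)
Lemma resolvent_absurd : False.
Proof.
have [l lmax] := g_max; have [K K0 BK] := Bb l.
pose b := B l; have blin := Blin l : linear b.
pose u0 := g l; pose u1 := b u0; pose m := nm u0; pose q := nm u1.
have m0 : 0 < m by apply: nm_gt0; exact: g_neq0.
have q0 : 0 < q.
  apply: nm_gt0; apply: contra_neq (g_neq0 l) => u10.
  by rewrite -/u0 -(SB l u0) -/b -/u1 u10 scaler0 (lin0 Slin) subrr.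
have step mu : g (l + mu) = u0 + mu *: b (g (l + mu)).
  by rewrite {1}/g (resolvent_eq l) addrAC subrr add0r.
have step2 mu : g (l + mu) = u0 + mu *: u1 + mu ^+ 2 *: b (b (g (l + mu))).
  rewrite {1}step {1}(congr1 b (step mu)) (linD blin) (linZ blin).
  by rewrite scalerDr scalerA -expr2 addrA.
pose P mu := g (l + mu) + g (l - mu); pose Q mu := g (l + mu) - g (l - mu).
have PE mu : P mu = 2 *: u0 + mu ^+ 2 *: b (b (P mu)).
  rewrite /P {1}step2 {1}(step2 (- mu)) !(linD blin) sqrrN scaleNr.
  by rewrite addrACA -scalerDr addrACA subrr addr0 scaler_nat mulr2n.
have QE mu : Q mu = (2 * mu) *: u1 + mu ^+ 2 *: b (b (Q mu)).
  rewrite /Q {1}step2 {1}(step2 (- mu)) !(linB blin) sqrrN scaleNr.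
  rewrite opprD addrACA -scalerBr opprD opprK addrACA subrr add0r -scalerDl.
  by rewrite mulr_natl mulr2n.
have PQ mu : nm (P mu) ^+ 2 + nm (Q mu) ^+ 2 <= 4 * m ^+ 2.
  rewrite parallelogram -mulrDr.
  have h k : nm (g k) ^+ 2 <= m ^+ 2 by rewrite ler_sqr ?nnegrE ?nm_ge0 ?lmax.
  by have := h (l + mu); have := h (l - mu); lra.
(* Each summand of [D] yields one smallness condition on [t = D^-1]: [t1], [tK], [tKm] and
   [tKm2]. *)
pose D := 1 + K ^+ 4 + 2 * (K ^+ 4 * m / q) + 9 * (K ^+ 4 * m ^+ 2 / q ^+ 2).
have K40 : 0 <= K ^+ 4 by rewrite exprn_ge0.
have a0 : 0 <= K ^+ 4 * m / q by rewrite !mulr_ge0 ?invr_ge0// ltW.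
have b0 : 0 <= K ^+ 4 * m ^+ 2 / q ^+ 2.
  by rewrite !mulr_ge0 ?invr_ge0 ?exprn_ge0// ltW.
have D0 : 0 < D by rewrite /D; lra.
pose t := D^-1; have t0 : 0 < t by rewrite invr_gt0.
have tD : t * D = 1 by rewrite mulVf// gt_eqF.
have tX X : X <= D -> t * X <= 1 by move=> XD; rewrite -tD ler_wpM2l// ltW.
have t1 : t <= 1 by rewrite -[t]mulr1; apply: tX; rewrite /D; lra.
have tK : t * K ^+ 4 <= 1 by apply: tX; rewrite /D; lra.
have tKm : 2 * (t * K ^+ 4 * m) <= q.
  have : t * (2 * (K ^+ 4 * m / q)) <= 1 by apply: tX; rewrite /D; lra.
  by rewrite !mulrA ler_pdivrMr// mul1r; lra.
have tKm2 : 9 * (t * K ^+ 4 * m ^+ 2) <= q ^+ 2.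
  have : t * (9 * (K ^+ 4 * m ^+ 2 / q ^+ 2)) <= 1.
    by apply: tX; rewrite /D; lra.
  by rewrite !mulrA ler_pdivrMr ?exprn_gt0// mul1r; lra.
pose mu := t%:C : R[i]; pose nu := 'i * mu.
have nu2 : nu ^+ 2 = - mu ^+ 2 by rewrite exprMn sqr_i mulN1r.
pose s0 := P mu + P nu; pose s1 := Q mu - 'i *: Q nu.
(* Since [nu ^+ 2 = - mu ^+ 2], the second-order term of [s0] involves [P mu - P nu], whose own
   constant terms cancel; only a fourth-order term is left. *)
have s0E : s0 = 4 *: u0 + mu ^+ 4 *: b (b (b (b s0))).
  have d0 : P mu - P nu = mu ^+ 2 *: b (b s0).
    rewrite PE (PE nu) nu2 scaleNr opprD opprK addrACA subrr add0r -scalerDr.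
    by rewrite -!(linD blin).
  rewrite {1}/s0 PE (PE nu) nu2 scaleNr addrACA -scalerBr -!(linB blin) d0.
  by rewrite !(linZ blin) scalerA -exprD -scalerDl -natrD.
have s1E : s1 = (4 * mu) *: u1 + mu ^+ 4 *: b (b (b (b s1))).
  have nuE : 'i *: ((2 * nu) *: u1) = - ((2 * mu) *: u1).
    rewrite scalerA -scaleNr; congr (_ *: _).
    by rewrite /nu mulrCA (mulrA 'i) -expr2 sqr_i mulN1r mulrN.
  have iw (w : H) : 'i *: (- mu ^+ 2 *: w) = - (mu ^+ 2 *: ('i *: w)).
    by rewrite scalerA mulrN scaleNr mulrC -scalerA.
  have d0 : Q mu + 'i *: Q nu = mu ^+ 2 *: b (b s1).
    rewrite QE (QE nu) nu2 scalerDr nuE addrACA subrr add0r.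
    rewrite iw -scalerBr.
    by rewrite -!(linZ blin) -!(linB blin) !(linZ blin).
  rewrite {1}/s1 QE (QE nu) nu2 scalerDr nuE opprD opprK addrACA.
  rewrite iw opprK -scalerDl -(scalerDr (mu ^+ 2)).
  have bbD x y : b (b x) + 'i *: b (b y) = b (b (x + 'i *: y)).
    by rewrite !(linD blin) !(linZ blin).
  rewrite bbD d0.
  by rewrite !(linZ blin) scalerA -exprD -mulrDl -natrD.
pose k := t ^+ 4 * K ^+ 4.
have bnd s : nm (mu ^+ 4 *: b (b (b (b s)))) <= k * nm s.
  rewrite -rmorphXn nmZr ?exprn_ge0 ?(ltW t0)// /k -mulrA.
  rewrite ler_wpM2l ?exprn_ge0 ?(ltW t0)//.
  do 3 (rewrite (le_trans (BK _))// exprS -mulrA ler_wpM2l//).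
have s01 : nm s0 ^+ 2 + nm s1 ^+ 2 <= 16 * m ^+ 2.
  have nmi (x : H) : nm ('i *: x) = nm x by rewrite nmZ /nm normCi mul1r.
  have := parallelogram (P mu) (P nu).
  have := parallelogram (Q mu) ('i *: Q nu).
  have := PQ mu; have := PQ nu; rewrite -/s0 -/s1 nmi.
  have := sqr_ge0 (nm (P mu - P nu)); have := sqr_ge0 (nm (Q mu + 'i *: Q nu)).
  by lra.
have k0 : 0 <= k by rewrite mulr_ge0// exprn_ge0// ltW.
have s0m : nm s0 <= 4 * m.
  by have := nm_ge0 s0; have := sqr_ge0 (nm s1); nra.
have s1m : nm s1 <= 4 * m.
  by have := nm_ge0 s1; have := sqr_ge0 (nm s0); nra.
have n4 : (4 : R[i]) = (4 : R)%:C by rewrite rmorph_nat.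
have s0ge : 4 * m - k * (4 * m) <= nm s0.
  have : nm (4 *: u0) <= nm s0 + k * nm s0.
    have -> : 4 *: u0 = s0 - mu ^+ 4 *: b (b (b (b s0))).
      by rewrite {1}s0E addrK.
    by rewrite (le_trans (nmB _ _))// lerD2l.
  rewrite n4 nmZr// -/m => h.
  have : k * nm s0 <= k * (4 * m) by rewrite ler_wpM2l.
  by lra.
have s1ge : 4 * t * q - k * (4 * m) <= nm s1.
  have : nm ((4 * mu) *: u1) <= nm s1 + k * nm s1.
    have -> : (4 * mu) *: u1 = s1 - mu ^+ 4 *: b (b (b (b s1))).
      by rewrite {1}s1E addrK.
    by rewrite (le_trans (nmB _ _))// lerD2l.
  rewrite n4 -rmorphM nmZr ?mulr_ge0 ?(ltW t0)// -/q => h.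
  have : k * nm s1 <= k * (4 * m) by rewrite ler_wpM2l.
  by lra.
pose h := t * K ^+ 4; have h0 : 0 <= h by rewrite mulr_ge0// ltW.
have t2 : t ^+ 2 <= 1 by rewrite expr_le1// ltW.
have kE : k = t ^+ 2 * (t * h) by rewrite /k /h; ring.
have th0 : 0 <= t * h by rewrite mulr_ge0// ltW.
have kth : k <= t * h by rewrite kE ler_piMl.
have kt2h : k <= t ^+ 2 * h.
  by rewrite kE ler_wpM2l ?exprn_ge0 ?(ltW t0)// ler_piMl.
have k1 : k <= 1 by rewrite (le_trans kth)// mulr_ile1// ltW.
have km : 2 * (k * m) <= t * q.
  have : k * m <= t * h * m by rewrite ler_wpM2r// ltW.
  have : t * (2 * (h * m)) <= t * q by rewrite ler_wpM2l// ltW.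
  by lra.
have km2 : 9 * (k * m ^+ 2) <= t ^+ 2 * q ^+ 2.
  have : k * m ^+ 2 <= t ^+ 2 * h * m ^+ 2.
    by rewrite ler_wpM2r// exprn_ge0// ltW.
  have : t ^+ 2 * (9 * (h * m ^+ 2)) <= t ^+ 2 * q ^+ 2.
    by rewrite ler_wpM2l// exprn_ge0// ltW.
  by lra.
have tq : 0 < t * q by rewrite mulr_gt0.
have e0 : (4 * m - k * (4 * m)) ^+ 2 <= nm s0 ^+ 2.
  rewrite ler_sqr ?nnegrE ?nm_ge0//.
  by rewrite -{1}[4 * m]mul1r -mulrBl mulr_ge0 ?subr_ge0// mulr_ge0// ltW.
have e1 : (4 * t * q - k * (4 * m)) ^+ 2 <= nm s1 ^+ 2.
  by rewrite ler_sqr ?nnegrE ?nm_ge0//; lra.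
have e2 : (2 * (t * q)) ^+ 2 <= (4 * t * q - k * (4 * m)) ^+ 2.
  by rewrite ler_sqr ?nnegrE; lra.
have e3 : 0 < (t * q) ^+ 2 by rewrite exprn_gt0.
have e4 : 0 <= (k * m) ^+ 2 by exact: sqr_ge0.
(* Expanding [e0] and adding [e1], [e2] in [s01] gives [4 * (t * q) ^+ 2 <= 32 * (k * m ^+ 2)],
   whereas [km2] bounds the right side by [32 / 9 * (t * q) ^+ 2]. *)
move: e0 e2 e3 e4 km2; rewrite !exprMn; nra.
Qed.

End Spectrum.

(** [bounded_approximation_everywhere] is used twice: on the graph of [S], to make [S] bounded and
    everywhere defined, and on the graphs of the inverses of [S - l], to produce the resolvents that
    [resolvent_absurd] excludes. *)
Lemma bounded_approximation_scalar_commutant {R : realType} {H : hilbertType R}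
    (A : set (H -> H)) :
  transitive_algebra A -> bounded_approximation A -> scalar_commutant A.
Proof.
move=> hA A3 S Sd Sc SA.
have A_linear T : A T -> linear T by case: hA => -[Ab _ _ _] _ _ /Ab[].
have GA := (graph_invariant A S).1 SA.
have GLat : Lat (ampliation2 @` A) (graph S).
  by split; [exact: graph_subspace|exact: Sc|].
have [[x Sx x0]|] := dense_nonzero _ Sd; last exact: is_scalar_trivial.
have Gx : graph S (x, fn S x) by exists x.
have [C C0 SC] := bounded_approximation_everywhere _ _ _ _ A3 GLat Gx x0.
have ST : dom S = setT.
  by apply/seteqP; split=> // z _; have [w /graphE[]] := SC z.
have domS z : dom S z by rewrite ST.
have GS z : graph S (z, fn S z) by exists z.
have SE z w : graph S (z, w) -> w = fn S z by move=> /graphE[].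
have {}SC z : nm (fn S z) <= C * nm z by have [w /SE ->] := SC z.
have Slin : linear (fn S) by move=> a y z; exact: fn_linear.
apply: contrapT => nscalar.
have preim_closed (V : normedModType R[i]) (f : V -> H * H) :
    continuous f -> closed (f @^-1` graph S).
  by move=> fc; apply: preimage_closed => // u _; exact: fc.
(* An eigenspace is closed and invariant under [A]; if nonzero it is all of [H], and [S] is
   scalar. *)
have inj l y : fn S y = l *: y -> y = 0.
  move=> yl; apply: contrapT => /eqP y0; apply: nscalar; exists l; split=> // z.
  suff : [set z | fn S z = l *: z] = setT by move=> /seteqP[_ /(_ z)]; exact.
  apply: (transitive_Lat A hA _ y) => //; split.
  - split=> [|a p q /= pE qE]; first by rewrite /= (lin0 Slin) scaler0.
    by rewrite Slin pE qE scalerDr !scalerA mulrC.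
  - have -> : [set z | fn S z = l *: z] = (fun z => (z, l *: z)) @^-1` graph S.
      by apply/seteqP; split=> p; [move=> /= <-; exact: GS|move=> /SE/esym].
    apply: preim_closed => p; apply: cvg_pair => /=; first exact: cvg_id.
    by apply: cvgZl_tmp; exact: cvg_id.
  - move=> T AT p /= pE; have [_ <-] := SA T AT p (domS p).
    by rewrite pE (linZ (A_linear _ AT)).
(* [G l] is the graph of the inverse of [S - l]: its pairs [(z, w)] satisfy [S w = z + l *: w]. *)
pose G l := [set u : H * H | graph S (u.2, u.1 + l *: u.2)].
have GlLat l : Lat (ampliation2 @` A) (G l).
  split.
  - split=> [|a u v Gu Gv]; rewrite /G/=.
      by rewrite scaler0 addr0; exact: subspace0 (graph_subspace S).
    have := (graph_subspace S).2 a _ _ Gu Gv.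
    rewrite -[X in graph S X -> _]/(_, _)/= !scalerDr addrACA !scalerA.
    by rewrite (mulrC a).
  - apply: (preim_closed _ (fun u : H * H => (u.2, u.1 + l *: u.2))) => u.
    apply: cvg_pair => /=; first exact: cvg_snd.
    by apply: cvgD; [exact: cvg_fst|apply: cvgZl_tmp; exact: cvg_snd].
  - move=> _ [T AT <-] u /(GA (ampliation2 T) _).
    rewrite /ampliation2/G/= (linD (A_linear _ AT)) (linZ (A_linear _ AT)).
    by apply; exists T.
have Bex l : exists BK : (H -> H) * R, 0 <= BK.2 /\
    forall z, G l (z, BK.1 z) /\ nm (BK.1 z) <= BK.2 * nm z.
  have [y yl] : exists y, fn S y - l *: y != 0.
    exists x; apply: contra_neq x0 => /eqP; rewrite subr_eq0 => /eqP.
    exact: inj.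
  have Gy : G l (fn S y - l *: y, y) by rewrite /G/= subrK.
  have [K K0 GK] := bounded_approximation_everywhere _ _ _ _ A3 (GlLat l) Gy yl.
  have /choice[f fK] z : exists w, G l (z, w) /\ nm w <= K * nm z.
    by have [w] := GK z; exists w.
  by exists (f, K).
have /choice[BK BK_] := Bex.
have SB l z : fn S ((BK l).1 z) - l *: (BK l).1 z = z.
  by have [/SE <- _] := (BK_ l).2 z; rewrite addrK.
apply: (resolvent_absurd (fn S) C Slin SC (fun l => (BK l).1) SB _ _ x x0).
(* The right inverse is also a left inverse because [S - l] is injective. *)
- move=> l z; have /eqP := SB l (fn S z - l *: z).
  set w := (BK l).1 _; rewrite subr_eq => /eqP Sw.
  apply/eqP; rewrite -subr_eq0; apply/eqP/(inj l).
  rewrite (linB Slin) Sw scalerBr addrAC [fn S z - _]addrC addrK.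
  by rewrite addrC.
- move=> l; exists (BK l).2 => [|z]; first exact: (BK_ l).1.
  exact: ((BK_ l).2 z).2.
Qed.

Theorem proposition1p2 (R : realType) (H : hilbertType R) (A : set (H -> H))
    (hA : transitive_algebra A) :
  [<->
    (* (1) *)
    two_fold_transitive A;
    (* (2) *)
    forall S : unbounded_operator H,
      dense (dom S) -> closed_operator S ->
      (forall T, A T -> commutes_with T S) -> is_scalar S;
    (* (3) *)
    forall x y z : H, x != 0 ->
      exists T : nat -> H -> H,
        [/\ forall n, A (T n),
            (fun n => T n x) @ \oo --> z &
            exists M : R[i], forall n, `|T n y| <= M];
    (* (4) *)
    Lat (ampliation2 @` A) = Lat (ampliation2 @` bounded_operators H);
    (* (4), in terms of projections; a projection is in Lat iff its range is *)
    forall P : H * H -> H * H,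
      projection2 P -> Lat (ampliation2 @` A) (range P) ->
      range scalar_operator2 P].
Proof.
(* The five conditions are proved in a cycle; (2) => (3) passes through (1), (3) => (4) through (2),
   and the projection form returns to (1) through (4) and (2). *)
tfae.
- exact: two_fold_scalar_commutant.
- move=> /(scalar_commutant_two_fold A hA).
  exact: two_fold_bounded_approximation.
- move=> /(bounded_approximation_scalar_commutant A hA).
  exact: scalar_commutant_Lat.
- exact: Lat_projection.
- move=> /projection_Lat -/(_ hA)/Lat_scalar_commutant.
  exact: scalar_commutant_two_fold.
Qed.
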